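(* Let $n \geq 2$. Then \[ \mathbf{R}_{n}^2 \left\|\frac{f}{|x|^2}\right\|_{2}^2 \leq \|\Delta_r f\|_2^2 \] holds for all $f \in C^\infty_0(\mathbb{R}^n \setminus \{0\})$. If $n \geq 3$, then \[ \|\Delta_r f\|_2\le C\|\Delta f\|_2 \] holds for all $f \in C^\infty_0(\mathbb{R}^n \setminus \{0\})$ with $C = 1$. When $n=2$, for every constant $C<\infty$, the inequality $\|\Delta_r f\|_2\le C\|\Delta f\|_2$ fails for some $f \in C^\infty_0(\mathbb{R}^2 \setminus \{0\})$. Furthermore, the constants are best possible: for each $n\ge 2$ the constant $\mathbf{R}_n^2$ in the inequality $\mathbf{R}_{n}^2 \left\|\frac{f}{|x|^2}\right\|_{2}^2 \leq \|\Delta_r f\|_2^2$ cannot be replaced by any larger constant, and for each $n\ge 3$ the constant $C=1$ in the inequality $\|\Delta_r f\|_2\le C\|\Delta f\|_2$ cannot be replaced by any smaller constant.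
   Context: $\|\cdot\|_2$ denotes the norm of $L^2(\mathbb{R}^n)$ (Lebesgue measure). $\mathbf{R}_n = \frac{n(n-4)}{4}$. $\Delta$ is the standard Laplacian on $\mathbb{R}^n$. The radial derivative is $\partial_r = \frac{x}{|x|}\cdot\nabla$ and the radial Laplacian is $\Delta_r f = \partial_r^2 f + \frac{n-1}{|x|}\partial_r f$. *)

(* Defs.v *)
From HB Require Import structures.
From mathcomp Require Import all_boot all_order all_algebra.
From mathcomp Require Import all_classical all_reals all_analysis.
From mathcomp Require Import complex.

Set Implicit Arguments.
Unset Strict Implicit.
Unset Printing Implicit Defensive.
Import Order.TTheory GRing.Theory Num.Theory.
Import numFieldNormedType.Exports.

Local Open Scope classical_set_scope.
Local Open Scope ring_scope.
Local Open Scope complex_scope.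

Section tuple_measure.
Context d (T : measurableType d) (R : realType).

Definition cons_pair (n : nat) (p : T * n.-tuple T) : n.+1.-tuple T :=
  [the n.+1.-tuple T of p.1 :: p.2].

Lemma measurable_cons_pair n : measurable_fun setT (@cons_pair n).
Proof. exact: measurable_cons. Qed.

Section step.
Variables (m1 : {sigma_finite_measure set T -> \bar R}) (n : nat).
Variable m : {sigma_finite_measure set (n.-tuple T) -> \bar R}.

Definition measure_cons : set (n.+1.-tuple T) -> \bar R :=
  pushforward (m1 \x m)%E (@cons_pair n).

Let mcp A : measurable A -> measurable (@cons_pair n @^-1` A).
Proof.
by move=> mA; rewrite -[X in measurable X]setTI; exact: measurable_cons_pair.
Qed.

Let measure_cons0 : measure_cons set0 = 0%E.
Proof. by rewrite /measure_cons /pushforward preimage_set0 measure0. Qed.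

Let measure_cons_ge0 A : (0 <= measure_cons A)%E.
Proof. exact: (measure_ge0 (m1 \x m)%E). Qed.

Let measure_cons_sigma_additive : semi_sigma_additive measure_cons.
Proof.
move=> F mF tF mUF; rewrite /measure_cons /pushforward preimage_bigcup.
apply: measure_semi_sigma_additive.
- by move=> k; exact: mcp.
- apply/trivIsetP => /= i j _ _ ij; rewrite -preimage_setI.
  by move/trivIsetP : tF => /(_ _ _ _ _ ij) ->//; rewrite preimage_set0.
- by rewrite -preimage_bigcup; exact: mcp.
Qed.

HB.instance Definition _ := isMeasure.Build _ _ _ measure_cons
  measure_cons0 measure_cons_ge0 measure_cons_sigma_additive.

Let uncons (t : n.+1.-tuple T) : T * n.-tuple T :=
  (thead t, [tuple of behead t]).

Let unconsK : cancel (@cons_pair n) uncons.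
Proof. by move=> [x t]; congr pair; apply/val_inj. Qed.

Let measurable_uncons : measurable_fun setT uncons.
Proof.
apply: measurable_fun_pair; last exact: measurable_behead.
exact: measurable_tnth.
Qed.

Let measure_cons_sigma_finite : sigma_finite setT measure_cons.
Proof.
have /sigma_finiteP[G [GT ndG Goo]] := sigma_finiteT m.
have /sigma_finiteP[H [HT ndH Hoo]] := sigma_finiteT m1.
exists (fun k => uncons @^-1` (H k `*` G k)).
  rewrite -preimage_bigcup (_ : \bigcup_k (H k `*` G k) = setT) ?preimage_setT//.
  apply/seteqP; split=> // -[x y] _.
  have [i _ Hix] : (\bigcup_k H k) x by rewrite -HT.
  have [j _ Gjy] : (\bigcup_k G k) y by rewrite -GT.
  exists (maxn i j) => //; split.
  - by move: x Hix; exact/subsetPset/ndH/leq_maxl.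
  - by move: y Gjy; exact/subsetPset/ndG/leq_maxr.
move=> k; have [mH Hk] := Hoo k; have [mG Gk] := Goo k; split.
  rewrite -[X in measurable X]setTI.
  by apply: measurable_uncons => //; exact: measurableX.
rewrite /measure_cons /pushforward -comp_preimage.
rewrite (_ : uncons \o _ = id); last by apply/funext => p; exact: unconsK.
by rewrite preimage_id product_measure1E// lte_mul_pinfty// ge0_fin_numE.
Qed.

HB.instance Definition _ := Measure_isSigmaFinite.Build _ _ _ measure_cons
  measure_cons_sigma_finite.

End step.

(* The n-fold product measure; [tuple_measure_box] below gives its values on
   boxes. *)
Fixpoint tuple_measure (m1 : {sigma_finite_measure set T -> \bar R}) (n : nat) :
    {sigma_finite_measure set (n.-tuple T) -> \bar R} :=
  match n with
  | 0 => dirac [tuple of [::]]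
  | n'.+1 => measure_cons m1 (tuple_measure m1 n')
  end.

Lemma tuple_measure_box (m1 : {sigma_finite_measure set T -> \bar R}) (n : nat)
    (A : 'I_n -> set T) : (forall i, measurable (A i)) ->
  tuple_measure m1 n [set t | forall i, A i (tnth t i)] =
  (\prod_(i < n) m1 (A i))%E.
Proof.
elim: n A => [|n IHn] A mA.
  rewrite big_ord0 /= diracE mem_set//= => -[]//.
rewrite big_ord_recl -IHn// /= /measure_cons /pushforward.
rewrite -product_measure1E//.
  congr (_ _); apply/seteqP; split=> [[x t]/= H|[x t]/= [H0 H] i].
    split; first by have := H ord0; rewrite tnth0.
    by move=> i; have := H (lift ord0 i); rewrite tnthS.
  by case: (unliftP ord0 i) => [j ->|->]; [rewrite tnthS|rewrite tnth0].
rewrite [X in measurable X](_ : _ = \bigcap_(i in [set: 'I_n])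
  ((@tnth n T ^~ i) @^-1` A (lift ord0 i))).
  apply: fin_bigcap_measurable => // i _.
  by rewrite -[X in measurable X]setTI; exact: measurable_tnth.
by apply/seteqP; split=> t /= H i; [move=> _|]; exact: H.
Qed.

End tuple_measure.

Section rellich_notions.
Context (R : realType) (n : nat).
Local Notation rpart := (@complex.Re R).
Local Notation ipart := (@complex.Im R).
Implicit Types (f : 'rV[R]_n -> R[i]) (x : 'rV[R]_n).

(* The Borel version of the Lebesgue measure on R^n, with n-tuples as points.
   All functions whose norm is taken below are Borel, so that completing the
   measure would not change anything. *)
Definition lebesgue_tuple :
    {sigma_finite_measure set (n.-tuple (measurableTypeR R)) -> \bar R} :=
  tuple_measure (@lebesgue_measure R) n.

Definition L2norm f : \bar R :=
  'N[lebesgue_tuple]_2%:E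
    [EFin \o (fun t => ComplexField.Normc.normc (f (\row_i tnth t i)))]%E.

(* The norm of the library on 'rV[R]_n is the sup norm. *)
Definition enorm x : R := Num.sqrt (\sum_(i < n) x 0 i ^+ 2).

Definition partial (i : 'I_n) f x : R[i] :=
  'D_(delta_mx 0 i) (rpart \o f) x +i* 'D_(delta_mx 0 i) (ipart \o f) x.

Definition smooth f : Prop :=
  forall s : seq 'I_n, let g := foldr partial f s in
    [/\ continuous (rpart \o g), continuous (ipart \o g) &
        forall x i, derivable (rpart \o g) x (delta_mx 0 i) /\
                    derivable (ipart \o g) x (delta_mx 0 i)].

(* C_0^oo(R^n \ {0}): its elements are identified with their extensions by 0
   to R^n. *)
Definition punctured_test_function f : Prop :=
  let supp := closure [set x | f x != 0] in
  [/\ smooth f, compact supp & ~ supp 0].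

Definition laplacian f x : R[i] := \sum_(i < n) partial i (partial i f) x.

(* At x = 0, where x / |x| is not defined, this takes the value 0. *)
Definition radial_derivative f x : R[i] :=
  \sum_(i < n) (x 0 i / enorm x)%:C * partial i f x.

Definition radial_laplacian f x : R[i] :=
  radial_derivative (radial_derivative f) x +
  ((n%:R - 1) / enorm x)%:C * radial_derivative f x.

Definition div_norm_sq f x : R[i] := f x / (enorm x ^+ 2)%:C.

Definition rellich_const : R := n%:R * (n%:R - 4) / 4.

End rellich_notions.
Arguments rellich_const : clear implicits.

(* Main.v *)
(* Let E = x . grad be the Euler field, L_ij = x_i d_j - x_j d_i the rotation
   fields, s = |x|^2, and <g, h> the scalar product of L^2(|x|^-4 dx).  For
   <.,.> the operators A = E + (n - 4) / 2 and L_ij are antisymmetric, and A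
   commutes with L_ij.  With c = n (n - 4) / 4 one has
     s Delta_r = E (E + n - 2) = A^2 + 2 A - c,   s Delta = s Delta_r + D,
   where D is half the sum of the L_ij^2, whence
     |s Delta_r f|^2 = |A^2 f|^2 + (2 c + 4) |A f|^2 + c^2 |f|^2,
   which is the first inequality because 2 c + 4 > 0, and
     2 <s Delta_r f, D f> = sum_ij (|A L_ij f|^2 + c |L_ij f|^2).
   This settles the second inequality when c >= 0, that is n >= 4.  When n = 3,
   c = -3/4 and the loss is absorbed by |D f|^2, thanks to the spectral gap
   |D f|^2 >= sum_ij |L_ij f|^2 of the sphere (Lichnerowicz' argument).
   Thus neither polar coordinates nor spherical harmonics are needed.

   For optimality let phi be a radial cutoff equal to a positive constant on a
   long range 2 <= s <= M.  The norms of E phi and E^2 phi in L^2(|x|^-n dx)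
   remain bounded while that of phi tends to infinity with M.  Then
   |x|^(-(n - 4) / 2) phi nearly realizes equality in the first inequality;
   being radial, it has Delta f = Delta_r f, so that C = 1 is optimal; and when
   n = 2, f = x_1 phi satisfies s Delta f = x_1 (E^2 phi + 2 E phi), with bounded
   norm, whereas |s Delta_r f|^2 >= |f|^2 is unbounded. *)
Require Import Defs.
From HB Require Import structures.
From mathcomp Require Import all_boot all_order all_algebra.
From mathcomp Require Import all_classical all_reals all_analysis.
From mathcomp Require Import measurable_realfun complex ring lra.
Import Order.TTheory GRing.Theory Num.Theory.
Import numFieldNormedType.Exports.

Set Implicit Arguments.
Unset Strict Implicit.
Unset Printing Implicit Defensive.

Local Open Scope classical_set_scope.
Local Open Scope ring_scope.
Local Open Scope complex_scope.

(** * Integration over tuples *)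

Section integration.
Context {R : realType}.
Implicit Types n : nat.

(** The weight |x|^-4 appears because the three functions whose norms are compared all have the form
    |x|^-2 g, where g comes from f by the identity, [rad_lap], or [rad_lap + sph_lap]. These
    operators have real coefficients, so the real and imaginary parts of f are treated separately
    and their squared norms added. The only analytic input to the inequalities is that a partial
    derivative of a test function has integral 0. The rest is algebra of vector fields, which is
    legitimate because multiplying by any power of |x| preserves functions vanishing near the
    origin. The spectral gap is just enough in dimension 3. With S the sum of all |L_ij f|^2, the
    cross term is at least c S = -(3/4) S and |D f|^2 is at least S. For n = 2 one has c = -1 while
    the circle only gives S / 2, in accordance with the failure there. For optimality the weight
    |x|^-n is the dilation invariant one: a function carried by a shell has norm bounded
    independently of the scale of the shell, whereas each dyadic cube inside the plateau of the
    cutoff contributes at least a fixed amount. No integral has to be computed exactly. *)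

Definition rv n (t : n.-tuple (measurableTypeR R)) : 'rV[R]_n :=
  \row_i tnth t i.

(** The sigma-algebra on tuples is generated by the coordinates, not by open sets of row vectors.
    [F] is therefore the pointwise limit of its values at the lattice point of mesh 1/(k+1) just
    below the argument. Such an approximation is constant on countably many cells, each a finite
    intersection of coordinate strips. *)
Lemma continuous_rv_measurable n (F : 'rV[R]_n -> R) :
  continuous F -> measurable_fun setT (F \o @rv n).
Proof.
move=> cF.
pose h (k : nat) (t : n.-tuple (measurableTypeR R)) : R :=
  F (\row_i ((Num.floor (k.+1%:R * (tnth t i : R)))%:~R / k.+1%:R)).
apply: (@measurable_fun_cvg _ _ _ setT h) => [k|t _].
  move=> _ Y mY; rewrite setTI.
  pose G (z : {ffun 'I_n -> int}) : set (n.-tuple (measurableTypeR R)) :=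
    if pselect (Y (F (\row_i ((z i)%:~R / k.+1%:R)))) then
      [set t | forall i, Num.floor (k.+1%:R * (tnth t i : R)) = z i]
    else set0.
  rewrite (_ : _ @^-1` _ = \bigcup_z G z); last first.
    apply/seteqP; split=> [t /= Yt|t [z _]].
      exists [ffun i => Num.floor (k.+1%:R * (tnth t i : R))] => //; rewrite /G.
      rewrite (_ : \row_i _ = \row_i
        ((Num.floor (k.+1%:R * (tnth t i : R)))%:~R / k.+1%:R)); last first.
        by apply/rowP => i; rewrite !mxE ffunE.
      by case: pselect => // Yx i /=; rewrite ffunE.
    rewrite /G; case: pselect => //= Yz H; rewrite /h.
    rewrite (_ : \row_i _ = \row_i ((z i)%:~R / k.+1%:R))//.
    by apply/rowP => i; rewrite !mxE (H i).
  apply: countable_bigcupT_measurable => [|z]; first exact: countableP.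
  rewrite /G; case: pselect => //= Yz.
  rewrite [X in measurable X](_ : _ = \bigcap_(i in [set: 'I_n])
    ((@tnth n (measurableTypeR R) ^~ i) @^-1`
      [set x : R | Num.floor (k.+1%:R * x) = z i])); last first.
    by apply/seteqP; split=> s /= H i; [move=> _|]; exact: H.
  apply: fin_bigcap_measurable => // i _.
  rewrite -[X in measurable X]setTI; apply: measurable_tnth => //.
  rewrite (_ : [set x | _] =
      `[(z i)%:~R / k.+1%:R, (z i + 1)%:~R / k.+1%:R[%classic) //.
  apply/seteqP; split=> x /=; rewrite in_itv/= ler_pdivrMr ?ltr0Sn//
    ltr_pdivlMr ?ltr0Sn// [x * _]mulrC.
    by move=> <-; exact: floor_itv.
  by move=> ?; apply/eqP; rewrite floor_eq.
rewrite /h; apply: (@cvg_comp _ _ _ _ F _ (nbhs (rv t))); last exact: cF.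
apply/cvgrPdist_lt => /= e e0.
have [N _ HN] := near_infty_natSinv_lt (PosNum e0).
exists N => // k /= Nk.
have : ball (rv t) e (\row_i ((Num.floor (k.+1%:R * (tnth t i : R)))%:~R / k.+1%:R)); last first.
  by rewrite -ball_normE /ball_/= distrC.
split=> // i j; rewrite !mxE/= /ball/=.
have k0 : 0 < k.+1%:R :> R by rewrite ltr0Sn.
have /andP[fl fu] := floor_itv (k.+1%:R * (tnth t j : R)).
move: fl fu; rewrite intrD; move: ((Num.floor _)%:~R : R) => m fl fu.
have -> : (tnth t j : R) - m / k.+1%:R = (k.+1%:R * tnth t j - m) / k.+1%:R.
  by field; rewrite nat1r pnatr_eq0.
rewrite normrM [X in _ * X]gtr0_norm ?invr_gt0//.
apply: le_lt_trans (HN k Nk); rewrite /= -[leRHS]mul1r ler_pM2r ?invr_gt0//.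
by rewrite ger0_norm ?subr_ge0// lerBlDl ltW.
Qed.

Lemma bounded_support_integrable d (T : measurableType d)
    (mu : {measure set T -> \bar R}) (f : T -> R) (A : set T) (K : R) :
  measurable A -> (mu A < +oo)%E -> measurable_fun setT f ->
  (forall x, `|f x| <= K) -> (forall x, ~ A x -> f x = 0) ->
  mu.-integrable setT (EFin \o f).
Proof.
move=> mA Aoo mf fK f0.
apply: (@le_integrable _ _ _ _ _ measurableT _ (EFin \o (fun x => K * \1_A x))).
- exact/measurable_EFinP.
- move=> x _ /=; rewrite lee_fin indicE.
  have [xA|xA] := boolP (x \in A).
    by rewrite mulr1 (le_trans (fK x))// ler_norm.
  rewrite mulr0 normr0 f0 ?normr0//.
  by move=> Ax; move: xA; rewrite (mem_set Ax).
- rewrite (_ : _ \o _ = (fun x => K%:E * (\1_A x)%:E)%E)//.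
  apply: integrableZl => //; apply/integrableP; split.
    exact/measurable_EFinP.
  rewrite (_ : (fun x => `|_|)%E = (fun x => (\1_A x)%:E)); last first.
    by apply/funext => x; rewrite /= ger0_norm// indicE.
  by rewrite integral_indic// setIT.
Qed.

Definition cube n (B : R) : set (n.-tuple (measurableTypeR R)) :=
  [set t | forall i, `|tnth t i : R| <= B].

Lemma box_measurable n (A : 'I_n -> set R) :
  (forall i, measurable (A i)) ->
  measurable [set t : n.-tuple (measurableTypeR R) | forall i, A i (tnth t i)].
Proof.
move=> mA; rewrite [X in measurable X](_ : _ = \bigcap_(i in [set: 'I_n])
  ((@tnth n (measurableTypeR R) ^~ i) @^-1` A i)).
  apply: fin_bigcap_measurable => // i _.
  by rewrite -[X in measurable X]setTI; apply: measurable_tnth => //; exact: mA.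
by apply/seteqP; split=> t /= H i; [move=> _|]; exact: H.
Qed.

Lemma cubeE n (B : R) : @cube n B =
  [set t | forall i, (fun=> `[- B, B]%classic) i (tnth t i : R)].
Proof.
by apply/seteqP; split => t /= H i; have := H i; rewrite /= in_itv/= ler_norml.
Qed.

Lemma cube_measurable n (B : R) : measurable (@cube n B).
Proof.
by rewrite cubeE; apply: (@box_measurable _ (fun=> `[- B, B]%classic)) => i.
Qed.

Lemma cube_measure n (B : R) : 0 <= B ->
  lebesgue_tuple R n (@cube n B) = ((B *+ 2) ^+ n)%:E.
Proof.
move=> B0; rewrite cubeE /lebesgue_tuple.
rewrite (tuple_measure_box (@lebesgue_measure R)
  (A := fun=> `[- B, B]%classic))//.
transitivity (\prod_(i < n) (B *+ 2)%:E)%E.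
  apply: eq_bigr => i _; rewrite [LHS]lebesgue_measure_itv/= lte_fin.
  case: ifPn => [_|]; first by rewrite -EFinB opprK -mulr2n.
  rewrite -leNgt => BN; have -> : B = 0 by lra.
  by rewrite mul0rn.
by rewrite prodEFin prodr_const card_ord.
Qed.

Definition upd n (t : n.-tuple (measurableTypeR R)) (i : 'I_n) (s : R) :
    n.-tuple (measurableTypeR R) :=
  [tuple (if j == i then s else tnth t j) | j < n].

Lemma upd_cons0 n (x : measurableTypeR R) (t : n.-tuple (measurableTypeR R)) s :
  upd [the n.+1.-tuple _ of x :: t] ord0 s = [the n.+1.-tuple _ of s :: t].
Proof.
apply/eq_from_tnth => j; rewrite tnth_mktuple.
by case: (unliftP ord0 j) => [k ->|->]; rewrite ?tnthS ?tnth0 ?eqxx.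
Qed.

Lemma upd_consS n (x : measurableTypeR R) (t : n.-tuple (measurableTypeR R)) i s :
  upd [the n.+1.-tuple _ of x :: t] (lift ord0 i) s =
  [the n.+1.-tuple _ of x :: upd t i s].
Proof.
apply/eq_from_tnth => j; rewrite tnth_mktuple.
case: (unliftP ord0 j) => [k ->|->]; rewrite ?tnthS ?tnth0//.
by rewrite tnth_mktuple (inj_eq (@lift_inj _ _)).
Qed.

Lemma integral_line_derivative0 (f F : R -> R) (B : R) :
  continuous f -> (forall s : R, is_derive s 1 F (f s)) ->
  (forall s, B < `|s| -> f s = 0) -> (forall s, B < `|s| -> F s = 0) ->
  (\int[@lebesgue_measure R]_s (f s)%:E = 0)%E.
Proof.
(* [B] may be negative; [|B| + 1] makes the interval nondegenerate and puts its endpoints where [F]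
   vanishes. *)
move=> cf dF f0 F0; pose b : R := `|B| + 1; pose D : set R := `[- b, b]%classic.
have b0 : 0 < b by rewrite /b ltr_wpDl.
have Bb : B < b by rewrite /b (le_lt_trans (ler_norm B))// ltrDl.
transitivity (\int[@lebesgue_measure R]_(s in D) (f s)%:E)%E.
  rewrite [RHS]integral_mkcond; apply: eq_integral => s _.
  rewrite patchE; case: ifPn => // sb; rewrite f0//.
  rewrite ltNge; apply/negP => sB; move: sb; rewrite notin_setE/= /D/= in_itv/=; apply.
  by rewrite -ler_norml (le_trans sB)// ltW.
rewrite /D (@continuous_FTC2 _ f F (- b) b).
- by rewrite !F0 ?subee// ?normrN gtr0_norm.
- by rewrite gtrN.
- exact: continuous_subspaceT.
- have cF s : {for s, continuous F}.
    by apply/differentiable_continuous/derivable1_diffP; case: (dF s).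
  split=> [s _| |].
  + by case: (dF s).
  + by apply: cvg_at_right_filter; exact: cF.
  + by apply: cvg_at_left_filter; exact: cF.
- by move=> s _; rewrite derive1E; case: (dF s).
Qed.

(** Induction on [n] by Fubini. If [i] is the first coordinate, the inner integral is taken along
    lines and vanishes by the fundamental theorem of calculus; otherwise it is taken over the tail
    and vanishes by induction. [F] and [G] are related only along lines of direction [i], so the
    hypotheses pass to slices. *)
Lemma integral_tuple_partial0 n (i : 'I_n)
    (F G : n.-tuple (measurableTypeR R) -> R) (K B : R) :
  measurable_fun setT F -> (forall t, `|F t| <= K) ->
  (forall t j, B < `|tnth t j : R| -> F t = 0) ->
  (forall t, B < `|tnth t i : R| -> G t = 0) ->
  (forall t, continuous (fun s => F (upd t i s))) ->
  (forall t (s : R), is_derive s 1 (fun s => G (upd t i s)) (F (upd t i s))) ->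
  (\int[lebesgue_tuple R n]_t (F t)%:E = 0)%E.
Proof.
elim: n => [|n IHn] in i F G *; first by case: i.
move=> mF FK F0 G0 cF dG.
pose m1 := (@lebesgue_measure R : {sigma_finite_measure set (measurableTypeR R) -> \bar R}).
have mc := @measurable_cons_pair _ (measurableTypeR R) n.
have intF : (m1 \x lebesgue_tuple R n)%E.-integrable setT
    (EFin \o (F \o (@cons_pair _ _ n))).
  apply: (@bounded_support_integrable _ _ _ _
    (@cons_pair _ _ n @^-1` @cube n.+1 `|B|) K).
  - rewrite -[X in measurable X]setTI; apply: mc => //.
    exact: cube_measurable.
  - rewrite [ltLHS](_ : _ = lebesgue_tuple R n.+1 (@cube n.+1 `|B|))//.
    by rewrite cube_measure// ltry.
  - exact: measurableT_comp.
  - by move=> x; exact: FK.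
  - move=> x /= /existsNP[j /negP]; rewrite -ltNge => Bj; apply: (F0 _ j).
    by rewrite (le_lt_trans _ Bj)// ler_norm.
transitivity (\int[m1 \x lebesgue_tuple R n]_p (F (cons_pair p))%:E)%E.
  rewrite /lebesgue_tuple/=/measure_cons/=.
  by rewrite integral_pushforward//; exact/measurable_EFinP.
case: (unliftP ord0 i) => [j|] ij; rewrite ij in G0 cF dG.
  rewrite -integral12_prod_meas1//.
  rewrite (eq_integral (fun=> 0%E)) ?integral0// => x _.
  rewrite /fubini_F/=.
  apply: (IHn j _ (fun t => G (cons_pair (x, t)))).
  - apply: measurableT_comp => //; apply: measurableT_comp => //.
  - by move=> t; exact: FK.
  - by move=> t k Bk; apply: (F0 _ (lift ord0 k)); rewrite tnthS.
  - by move=> t Bt; apply: G0; rewrite tnthS.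
  - move=> t; rewrite (_ : (fun s => _) =
        (fun s => F (upd (cons_pair (x, t)) (lift ord0 j) s))) //.
    by apply/funext => s; rewrite upd_consS.
  - move=> t s; rewrite (_ : (fun s => _) =
        (fun s => G (upd (cons_pair (x, t)) (lift ord0 j) s))); last first.
      by apply/funext => u; rewrite upd_consS.
    have := dG (cons_pair (x, t)) s; congr (is_derive _ _ _ _).
    by rewrite upd_consS.
rewrite -integral21_prod_meas1//.
rewrite (eq_integral (fun=> 0%E)) ?integral0// => t _.
rewrite /fubini_G/=.
apply: (@integral_line_derivative0 _ (fun s => G (@cons_pair _ (measurableTypeR R) n (s, t))) B).
- rewrite (_ : (fun s => _) = (fun s => F (upd (@cons_pair _ (measurableTypeR R) n (0 : R, t)) ord0 s))) //.
  by apply/funext => s; rewrite upd_cons0.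
- move=> s; rewrite (_ : (fun s => _) =
    (fun s => G (upd (@cons_pair _ (measurableTypeR R) n (0 : R, t)) ord0 s))); last first.
    by apply/funext => u; rewrite upd_cons0.
  have := dG (@cons_pair _ (measurableTypeR R) n (0 : R, t)) s; congr (is_derive _ _ _ _).
  by rewrite upd_cons0.
- by move=> s Bs; apply: (F0 _ ord0); rewrite tnth0.
- by move=> s Bs; apply: G0; rewrite tnth0.
Qed.

End integration.

(** * Directional derivatives and smooth functions *)

Definition evec {R : realType} {n : nat} (i : 'I_n) : 'rV[R]_n := delta_mx 0 i.

(* Locked: otherwise unification unfolds it down to limits. *)
HB.lock Definition pd {R : realType} {n : nat} (i : 'I_n) (f : 'rV[R]_n -> R)
  (x : 'rV[R]_n) : R := 'D_(evec i) f x.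

Section calculus.
Context {R : realType} {n : nat}.
Local Notation V := 'rV[R]_n.
Implicit Types (f g : V -> R) (x : V) (i j : 'I_n).

Lemma pdE i f x : pd i f x = 'D_(evec i) f x.
Proof. by rewrite pd.unlock. Qed.

Definition sq x : R := \sum_(i < n) x 0 i ^+ 2.
Definition coordf i x : R := x 0 i.

(** The hypothesis makes the two difference quotients equal as functions of the increment, so that
    one-variable theorems apply to directional derivatives without any total differentiability. *)
Lemma is_derive_line f x v (s : R) (g : R -> R) :
  (forall h, g (h + s) = f (h *: v + x)) -> derivable f x v ->
  is_derive s 1 g ('D_v f x).
Proof.
move=> gE df; have E : (fun h : R => h^-1 *: ((g \o shift s) (h *: 1) - g s)) =
    (fun h : R => h^-1 *: ((f \o shift x) (h *: v) - f x)).
  have gs : g s = f x by rewrite -{1}(add0r s) gE scale0r add0r.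
  by apply/funext => h /=; rewrite gE gs [h%:A]mulr1.
by apply: DeriveDef; rewrite ?/derivable ?/derive E.
Qed.

Lemma continuous_coord i : continuous (coordf i).
Proof. by move=> x; exact: coord_continuous. Qed.

Lemma sq_funE : sq = \sum_(i < n) coordf i * coordf i.
Proof.
by apply/funext => x; rewrite fct_sumE; apply: eq_bigr => i _; rewrite expr2.
Qed.

Lemma continuous_sq : continuous sq.
Proof.
rewrite sq_funE; elim/big_rec : _ => [|i f _ cf x].
  exact: cst_continuous.
apply: continuousD; last exact: cf.
by apply: continuousM; exact: continuous_coord.
Qed.

Lemma coord_sq_le x i : x 0 i ^+ 2 <= sq x.
Proof.
by rewrite /sq (bigD1 i)//= lerDl sumr_ge0// => j _; exact: sqr_ge0.
Qed.

Lemma sq_ge0 x : 0 <= sq x.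
Proof. by rewrite sumr_ge0// => i _; exact: sqr_ge0. Qed.

Lemma coord_norm_le x i : `|x 0 i| <= Num.sqrt (sq x).
Proof. by rewrite -sqrtr_sqr ler_wsqrtr// coord_sq_le. Qed.

Lemma norm_le_sqrt_sq x : `|x| <= Num.sqrt (sq x).
Proof.
rewrite /Num.norm/= mx_normrE; apply/bigmax_leP; split; first exact: sqrtr_ge0.
by move=> [i j] _ /=; rewrite ord1 coord_norm_le.
Qed.

Lemma sq_ball_compact (b : R) : compact [set x | sq x <= b].
Proof.
apply: bounded_closed_compact.
  exists (Num.sqrt b); split; first exact: num_real.
  move=> M bM x /= xb; rewrite (le_trans (norm_le_sqrt_sq x))//.
  by rewrite (le_trans _ (ltW bM))// ler_wsqrtr.
rewrite [X in closed X](_ : _ = sq @^-1` [set y | y <= b]); last by apply/seteqP; split.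
by apply: closed_comp => [x _|]; [exact: continuous_sq|exact: closed_le].
Qed.

Definition bounded_support f := exists b : R, forall x, b < sq x -> f x = 0.

Lemma continuous_bounded_support f : continuous f -> bounded_support f ->
  exists K : R, forall x, `|f x| <= K.
Proof.
move=> cf [b fb].
have : compact (f @` [set x | sq x <= b]).
  apply: continuous_compact; last exact: sq_ball_compact.
  exact: continuous_subspaceT.
move=> /compact_bounded[M [_ /(_ (`|M| + 1))]] H.
exists (`|M| + 1) => x.
have [xb|xb] := leP (sq x) b; last by rewrite fb// normr0 addr_ge0.
by apply: H; [rewrite (le_lt_trans (ler_norm M))// ltrDl|exists x].
Qed.

Definition integ f :=
  (lebesgue_tuple R n).-integrable setT (EFin \o (f \o @rv R n)).

Definition Itg f : R := \int[lebesgue_tuple R n]_t f (rv t).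

Lemma tnth_sq_le (t : n.-tuple (measurableTypeR R)) j :
  (tnth t j : R) ^+ 2 <= sq (rv t).
Proof. by have := coord_sq_le (rv t) j; rewrite mxE. Qed.

Lemma integ_bounded f (K b : R) : measurable_fun setT (f \o @rv R n) ->
  (forall x, `|f x| <= K) -> (forall x, b < sq x -> f x = 0) -> integ f.
Proof.
move=> mf fK fb; apply: (@bounded_support_integrable _ _ _ _ _ (@cube R n (Num.sqrt b)) K) => //.
- exact: cube_measurable.
- by rewrite [ltLHS](cube_measure _ (sqrtr_ge0 b)) ltry.
- by move=> t; exact: fK.
- move=> t /= /existsNP[j /negP]; rewrite -ltNge => bj; apply: fb.
  have [b0|b0] := leP 0 b; last by rewrite (lt_le_trans b0)// sq_ge0.
  rewrite (lt_le_trans _ (tnth_sq_le t j))// -(sqr_sqrtr b0).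
  by rewrite -[ltRHS]real_normK ?num_real// ltrXn2r// ?sqrtr_ge0.
Qed.

Lemma integ_continuous f : continuous f -> bounded_support f -> integ f.
Proof.
move=> cf bf; have [K fK] := continuous_bounded_support cf bf.
have [b fb] := bf; apply: (integ_bounded _ fK fb).
exact: continuous_rv_measurable.
Qed.

Lemma Itg_D f g : integ f -> integ g -> Itg (f + g) = Itg f + Itg g.
Proof. by move=> If Ig; rewrite /Itg -RintegralD. Qed.

Lemma Itg_Z (k : R) f : integ f -> Itg (k *: f) = k * Itg f.
Proof. by move=> If; rewrite /Itg -RintegralZl. Qed.

Lemma Itg_ge0 f : (forall x, 0 <= f x) -> 0 <= Itg f.
Proof. by move=> f0; apply: Rintegral_ge0 => t _; exact: f0. Qed.

Lemma Itg_le f g : integ f -> integ g -> (forall x, f x <= g x) -> Itg f <= Itg g.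
Proof. by move=> If Ig fg; apply: le_Rintegral => // t _; exact: fg. Qed.

Lemma rv_upd (t : n.-tuple (measurableTypeR R)) i (s : R) :
  rv (upd t i s) = (s - tnth t i) *: evec i + rv t.
Proof.
apply/rowP => j; rewrite !mxE tnth_mktuple eqxx/=.
by have [->|ij] := eqVneq j i; rewrite ?mulr1 ?mulr0 ?add0r// subrK.
Qed.

Lemma Itg_pd i f : continuous f -> bounded_support f ->
  (forall x, derivable f x (evec i)) -> continuous (pd i f) ->
  bounded_support (pd i f) -> Itg (pd i f) = 0.
Proof.
move=> cf [b fb] df cpf [b' pfb].
have [K fK] := continuous_bounded_support cpf (ex_intro _ b' pfb).
rewrite /Itg /Rintegral.
(* A coordinate larger than [B] pushes |x|^2 beyond both support bounds; the maximum with 0 is what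
   makes the square of the root equal to its argument. *)
pose B := Num.sqrt (Num.max 0 (Num.max b b')).
have Bb (t : n.-tuple (measurableTypeR R)) j : B < `|tnth t j : R| ->
    Num.max b b' < sq (rv t).
  move=> Bj; rewrite (lt_le_trans _ (tnth_sq_le t j))//.
  rewrite (le_lt_trans (y := B ^+ 2))//.
    by rewrite sqr_sqrtr; rewrite le_max lexx ?orbT.
  by rewrite -[ltRHS]real_normK ?num_real// ltrXn2r// ?sqrtr_ge0.
rewrite [X in fine X](_ : _ = 0%E)//.
apply: (@integral_tuple_partial0 _ _ i (pd i f \o @rv R n) (f \o @rv R n) K B).
- exact: continuous_rv_measurable.
- by move=> t; exact: fK.
- move=> t j /Bb tj; apply: pfb; rewrite (le_lt_trans _ tj)//.
  by rewrite le_max lexx ?orbT.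
- by move=> t /Bb tj; apply: fb; rewrite (le_lt_trans _ tj)// le_max lexx.
- move=> t s; apply: (@continuous_comp _ _ _ (fun s => rv (upd t i s)) (pd i f)); last exact: cpf.
  rewrite (_ : (fun s => _) = (fun s : R => (s - tnth t i) *: evec i + rv t)); last first.
    by apply/funext => u; rewrite rv_upd.
  apply: cvgD; last exact: cvg_cst.
  apply: cvgZr_tmp; apply: cvgB; first exact: cvg_id.
  exact: cvg_cst.
- move=> t s; rewrite /= pdE; apply: is_derive_line => // h; rewrite !rv_upd addrA -scalerDl.
  by rewrite addrA.
Qed.

(** Smoothness is graded by the order so that closure properties go by induction. In the Leibniz
    rule the undifferentiated factors are only needed at the lower order, which [CkW] provides. *)
Fixpoint Ck (k : nat) f : Prop :=
  continuous f /\
  if k is k'.+1 then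
    forall i, (forall x, derivable f x (evec i)) /\ Ck k' (pd i f)
  else True.

Definition Cinf f := forall k, Ck k f.

Lemma Ck_continuous k f : Ck k f -> continuous f.
Proof. by case: k => [|k] []. Qed.

Lemma CkW k f : Ck k.+1 f -> Ck k f.
Proof.
elim: k f => [|k IHk] f [cf H]; first by split.
by split=> // i; have [df Hp] := H i; split=> //; apply: IHk.
Qed.

Lemma Cinf_continuous f : Cinf f -> continuous f.
Proof. by move=> /(_ 0) []. Qed.

Lemma Cinf_derivable f i x : Cinf f -> derivable f x (evec i).
Proof. by move=> /(_ 1)[_ /(_ i)[]]. Qed.

Lemma Cinf_pd i f : Cinf f -> Cinf (pd i f).
Proof. by move=> Cf k; have [_ /(_ i)[]] := Cf k.+1. Qed.

Lemma pdD i f g : (forall x, derivable f x (evec i)) ->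
  (forall x, derivable g x (evec i)) -> pd i (f + g) = pd i f + pd i g.
Proof. by move=> df dg; apply/funext => x; rewrite [RHS]/= pdE deriveD// -!pdE. Qed.

Lemma pdM i f g : (forall x, derivable f x (evec i)) ->
  (forall x, derivable g x (evec i)) ->
  pd i (f * g) = f * pd i g + g * pd i f.
Proof. by move=> df dg; apply/funext => x; rewrite pdE deriveM// -!pdE. Qed.

Lemma pd_cst i (c : R) : pd i (cst c) = cst 0.
Proof. by apply/funext => x; rewrite pdE derive_cst. Qed.

Lemma is_derive_coord i j x : is_derive x (evec i) (coordf j) (j == i)%:R.
Proof.
have E : (fun h : R => h^-1 *: ((coordf j \o shift x) (h *: evec i) - coordf j x))
    @ 0^' --> ((j == i)%:R : R).
  apply: cvg_near_cst.
  near=> h; rewrite /= /coordf !mxE eqxx/= addrK.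
  by rewrite scalerA mulVf ?scale1r//; near: h; exact: nbhs_dnbhs_neq.
by apply: DeriveDef; [apply/cvg_ex; eexists; exact: E|exact/cvg_lim].
Unshelve. all: by end_near. Qed.

Lemma pd_coord i j : pd i (coordf j) = cst (j == i)%:R.
Proof. by apply/funext => x; rewrite pdE; case: (is_derive_coord i j x). Qed.

Lemma Ck_cst k (c : R) : Ck k (cst c).
Proof.
elim: k c => [|k IHk] c /=; split=> //; try exact: cst_continuous.
by move=> i; rewrite pd_cst; split => // x; exact: derivable_cst.
Qed.

Lemma Cinf_cst (c : R) : Cinf (cst c). Proof. by move=> k; exact: Ck_cst. Qed.

Lemma Cinf_coord i : Cinf (coordf i).
Proof.
case=> [|k]; split=> //; try exact: continuous_coord.
move=> j; split; last by rewrite pd_coord; exact: Ck_cst.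
by move=> x; case: (is_derive_coord j i x).
Qed.

Lemma Ck_D k f g : Ck k f -> Ck k g -> Ck k (f + g).
Proof.
elim: k f g => [|k IHk] f g [cf Hf] [cg Hg]; split=> //; try by move=> x; apply: continuousD; [exact: cf|exact: cg].
move=> i; have [df Hpf] := Hf i; have [dg Hpg] := Hg i.
rewrite (pdD df dg); split; last exact: IHk.
by move=> x; exact: derivableD.
Qed.

Lemma Ck_M k f g : Ck k f -> Ck k g -> Ck k (f * g).
Proof.
elim: k f g => [|k IHk] f g Cf Cg; have [cf Hf] := Cf; have [cg Hg] := Cg;
  split=> //; try by move=> x; apply: continuousM; [exact: cf|exact: cg].
move=> i; have [df Hpf] := Hf i; have [dg Hpg] := Hg i.
rewrite (pdM df dg); split; first by move=> x; exact: derivableM.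
by apply: Ck_D; apply: IHk => //; exact: CkW.
Qed.

Lemma Cinf_D f g : Cinf f -> Cinf g -> Cinf (f + g).
Proof. by move=> Cf Cg k; exact: Ck_D. Qed.

Lemma Cinf_M f g : Cinf f -> Cinf g -> Cinf (f * g).
Proof. by move=> Cf Cg k; exact: Ck_M. Qed.

Lemma scale_funE (c : R) f : c *: f = cst c * f.
Proof. by apply/funext => x. Qed.

Lemma Cinf_Z (c : R) f : Cinf f -> Cinf (c *: f).
Proof. by move=> Cf; rewrite scale_funE; apply: Cinf_M => //; exact: Cinf_cst. Qed.

Lemma Cinf_N f : Cinf f -> Cinf (- f).
Proof. by rewrite -scaleN1r; exact: Cinf_Z. Qed.

Lemma Cinf_sum (J : Type) (r : seq J) (F : J -> V -> R) :
  (forall a, Cinf (F a)) -> Cinf (\sum_(a <- r) F a).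
Proof.
move=> CF; elim/big_ind : _ => //; [exact: Cinf_cst|exact: Cinf_D].
Qed.

End calculus.

(** * Symmetry of second derivatives *)

Section schwarz.
Context {R : realType} {n : nat}.
Local Notation V := 'rV[R]_n.
Implicit Types (f g : V -> R) (x : V) (i j : 'I_n).

Lemma is_derive_pd_line f i x (s : R) : Cinf f ->
  is_derive s 1 (fun u : R => f (u *: evec i + x)) (pd i f (s *: evec i + x)).
Proof.
move=> Cf; rewrite pdE; apply: is_derive_line; last exact: Cinf_derivable.
by move=> h; rewrite scalerDl addrA.
Qed.

Lemma pd_mvt f i x (h : R) : 0 < h -> Cinf f ->
  exists2 s : R, 0 <= s <= h &
    f (h *: evec i + x) - f x = h * pd i f (s *: evec i + x).
Proof.
move=> h0 Cf.
have [s _||c ch E] := @MVT_segment R (fun u => f (u *: evec i + x))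
  (fun u => pd i f (u *: evec i + x)) 0 h (ltW h0).
- exact: is_derive_pd_line.
- apply: continuous_subspaceT => s; apply/differentiable_continuous/derivable1_diffP.
  by case: (is_derive_pd_line i x s Cf).
- exists c; first by move: ch; rewrite in_itv.
  by move: E; rewrite /= scale0r add0r subr0 mulrC.
Qed.

(** The second difference over a square of side [h] is an increment along [i] of the increment [F]
    along [j]; the mean value theorem is applied in each direction in turn. *)
Lemma mixed_pd_mvt f i j x (h : R) : 0 < h -> Cinf f ->
  exists s t : R, [/\ 0 <= s <= h, 0 <= t <= h &
    f (h *: evec i + (h *: evec j + x)) - f (h *: evec i + x)
      - f (h *: evec j + x) + f x =
    h ^+ 2 * pd j (pd i f) (s *: evec i + (t *: evec j + x))].
Proof.
move=> h0 Cf.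
pose F (u : R) := f (u *: evec i + (h *: evec j + x)) - f (u *: evec i + x).
have dF (s : R) : is_derive s 1 F (pd i f (s *: evec i + (h *: evec j + x))
    - pd i f (s *: evec i + x)).
  by apply: is_deriveB; exact: is_derive_pd_line.
have [|s sh E] := @MVT_segment R F _ 0 h (ltW h0) (fun s _ => dF s).
  apply: continuous_subspaceT => s; apply/differentiable_continuous/derivable1_diffP.
  by case: (dF s).
have [t th E2] := pd_mvt j (s *: evec i + x) h0 (Cinf_pd i Cf).
exists s, t; split; [by move: sh; rewrite in_itv|exact: th|].
move: E; rewrite /F /= !scale0r !add0r subr0 => E.
transitivity (f (h *: evec i + (h *: evec j + x)) - f (h *: evec i + x) -
  (f (h *: evec j + x) - f x)); first by move: (f _) (f _) (f _) (f _) => ? ? ? ?; ring.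
rewrite E [s *: _ + (_ + _)]addrCA E2 [X in pd j _ X]addrCA.
move: (pd j _ _) => P; ring.
Qed.

Lemma near_rect f i j x (e : R) : continuous f -> 0 < e ->
  exists2 h : R, 0 < h & forall s t, 0 <= s <= h -> 0 <= t <= h ->
    `|f (s *: evec i + (t *: evec j + x)) - f x| < e.
Proof.
move=> cf e0; have /cvgrPdist_lt/(_ e e0)/nbhs_ballP[d /= d0 Hd] := cf x.
(* Two displacements of sup norm at most d / 3 stay strictly inside the ball of radius d. *)
exists (d / 3); first by rewrite divr_gt0.
move=> s t /andP[s0 sd] /andP[t0 td]; rewrite distrC; apply: Hd.
split => // a k; rewrite !mxE /ball/=.
have : `|s * (delta_mx 0 i : V) a k| <= d / 3.
  by rewrite mxE; case: (_ && _); rewrite ?mulr1 ?mulr0 ?normr0 ?ger0_norm// divr_ge0// ltW.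
have : `|t * (delta_mx 0 j : V) a k| <= d / 3.
  by rewrite mxE; case: (_ && _); rewrite ?mulr1 ?mulr0 ?normr0 ?ger0_norm// divr_ge0// ltW.
rewrite /evec !mxE; move: (s * _) (t * _) => u v vd ud.
rewrite (_ : x a k - _ = - (u + v)); last by ring.
rewrite normrN (le_lt_trans (ler_normD _ _))//.
have := lerD ud vd; move=> /le_lt_trans; apply; lra.
Qed.

(** The second difference is symmetric in [i] and [j], so the two mixed derivatives take a common
    value at suitable points of a small square. By continuity each is within |d| / 2 of its value at
    [x], where d is their supposed discrepancy, whence |d| < |d|. *)
Lemma pd_comm f i j : Cinf f -> pd i (pd j f) = pd j (pd i f).
Proof.
move=> Cf; apply/funext => x; apply/eqP; rewrite -subr_eq0; apply/negP => /negP d0.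
set d := _ - _ in d0; pose e := `|d| / 2.
have e0 : 0 < e by rewrite divr_gt0// normr_gt0.
have [h h0 Hh] := near_rect i j x (Cinf_continuous (Cinf_pd j (Cinf_pd i Cf))) e0.
have [k k0 Hk] := near_rect i j x (Cinf_continuous (Cinf_pd i (Cinf_pd j Cf))) e0.
pose m := Num.min h k; have m0 : 0 < m by rewrite lt_min h0.
have mh : m <= h by rewrite ge_min lexx.
have mk : m <= k by rewrite ge_min lexx orbT.
have [s [t [/andP[s0 sm] /andP[t0 tm] E1]]] := mixed_pd_mvt i j x m0 Cf.
have [t' [s' [/andP[t0' tm'] /andP[s0' sm'] E2]]] := mixed_pd_mvt j i x m0 Cf.
have H2 := Hk s' t'.
have H1 := Hh s t; rewrite s0 t0 (le_trans sm)// (le_trans tm)// in H1.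
rewrite s0' t0' (le_trans sm')// (le_trans tm')// in H2.
have {}H1 := H1 isT isT; have {}H2 := H2 isT isT.
have E : pd j (pd i f) (s *: evec i + (t *: evec j + x)) =
         pd i (pd j f) (s' *: evec i + (t' *: evec j + x)).
  have C (u v : R) : u *: evec j + (v *: evec i + x) =
    v *: evec i + (u *: evec j + x) by rewrite addrCA.
  move: E1 E2; rewrite (C m m) (C t' s').
  move: (pd j (pd i f) _) (pd i (pd j f) _) => P Q.
  move: (f (m *: evec i + (m *: evec j + x))) => u1.
  move: (f (m *: evec i + x)) (f (m *: evec j + x)) => u2 u3 E1 E2.
  apply: (@mulfI _ (m ^+ 2)); first by rewrite expf_neq0// gt_eqF.
  rewrite -E1 -E2; ring.
have dE : d = (pd j (pd i f) (s *: evec i + (t *: evec j + x)) - pd j (pd i f) x)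
  - (pd i (pd j f) (s' *: evec i + (t' *: evec j + x)) - pd i (pd j f) x).
  by rewrite E opprB addrC addrA subrK.
have : `|d| < e + e.
  by rewrite dE; exact: (le_lt_trans (ler_normB _ _) (ltrD H1 H2)).
by rewrite /e -splitr ltxx.
Qed.

End schwarz.

(** * Test functions and powers of the radius *)

Section weights.
Context {R : realType} {n : nat}.
Local Notation V := 'rV[R]_n.
Implicit Types (f g h : V -> R) (x : V) (i j : 'I_n) (a b : R).

Lemma is_derive_comp1 (h : R -> R) f x v (dh df : R) :
  is_derive x v f df -> is_derive (f x) 1 h dh ->
  is_derive x v (h \o f) (dh * df).
Proof.
move=> [df1 df2] Hh; subst df.
have F1 : is_derive (0 : R) 1 (fun t : R => f (t *: v + x)) ('D_v f x).
  by apply: is_derive_line => // t; rewrite addr0.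
have F2 : is_derive (0 : R) 1 (fun t : R => h (f (t *: v + x))) (dh * 'D_v f x).
  apply: (@is_derive1_comp R h (fun t : R => f (t *: v + x))) => //.
  by rewrite scale0r add0r.
have E : (fun t : R => t^-1 *: (((h \o f) \o shift x) (t *: v) - (h \o f) x)) =
  (fun t : R => t^-1 *: (((fun t : R => h (f (t *: v + x))) \o shift 0) (t *: 1) -
     (fun t : R => h (f (t *: v + x))) 0)).
  by apply/funext => t /=; rewrite scale0r add0r addr0 [t%:A]mulr1.
case: F2 => F21 F22.
by apply: DeriveDef; [rewrite /derivable E|rewrite /derive E].
Qed.

Lemma pd_sum i (J : Type) (r : seq J) (F : J -> V -> R) :
  (forall k, Cinf (F k)) -> pd i (\sum_(k <- r) F k) = \sum_(k <- r) pd i (F k).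
Proof.
move=> CF; elim: r => [|a r IHr]; first by rewrite !big_nil; exact: pd_cst.
rewrite !big_cons pdD ?IHr// => x; apply: Cinf_derivable => //.
exact: Cinf_sum.
Qed.

Lemma Cinf_sq : Cinf (@sq R n).
Proof. by rewrite sq_funE; apply: Cinf_sum => i; apply: Cinf_M; exact: Cinf_coord. Qed.

Lemma pdZ i (c : R) f : Cinf f -> pd i (c *: f) = c *: pd i f.
Proof.
by move=> Cf; apply/funext => x; rewrite pdE deriveZ -?pdE//; exact: Cinf_derivable.
Qed.

Lemma pd_sq i : pd i (@sq R n) = 2 *: coordf i.
Proof.
rewrite sq_funE pd_sum; last by move=> j; apply: Cinf_M; exact: Cinf_coord.
rewrite (bigD1 i)//= big1 ?addr0 => [|j ji];
  rewrite pdM ?pd_coord ?eqxx; try by move=> ?; apply: Cinf_derivable; exact: Cinf_coord.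
  by apply/funext => x; rewrite !fctE /GRing.scale/= /cst; ring.
by rewrite (negbTE ji) [cst _](_ : _ = 0)// mulr0 addr0.
Qed.

(** The function vanishes on two open sets, so that its derivatives vanish there too, with the same
    bounds. *)
Definition annular f :=
  exists a b, 0 < a /\ forall x, sq x < a \/ b < sq x -> f x = 0.

Definition testfun f := Cinf f /\ annular f.

Lemma near_sq_lt x a : sq x < a -> \forall y \near x, sq y < a.
Proof.
move=> xa; have : nbhs (sq x) [set z | z < a] by exact: lt_nbhsl.
exact: continuous_sq.
Qed.

Lemma near_sq_gt x a : a < sq x -> \forall y \near x, a < sq y.
Proof.
move=> xa; have : nbhs (sq x) [set z | a < z] by exact: lt_nbhsr.
exact: continuous_sq.
Qed.

Lemma pd_near0 i f x : (\forall y \near x, f y = 0) -> pd i f x = 0.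
Proof.
move=> f0; rewrite pdE (near_eq_derive (g := cst 0))// ?derive_cst//.
Qed.

Lemma annular_pd i f : annular f -> annular (pd i f).
Proof.
move=> [a [b [a0 H]]]; exists a, b; split=> // x [xa|xb]; apply: pd_near0.
  by apply: filterS (near_sq_lt xa) => y ya; apply: H; left.
by apply: filterS (near_sq_gt xb) => y yb; apply: H; right.
Qed.

Lemma annular_M f g : annular f -> annular (g * f).
Proof.
by move=> [a [b [a0 H]]]; exists a, b; split=> // x /H; rewrite fctE => ->; rewrite mulr0.
Qed.

Lemma annular_D f g : annular f -> annular g -> annular (f + g).
Proof.
move=> [a [b [a0 H]]] [a' [b' [a0' H']]].
exists (Num.min a a'), (Num.max b b'); split; first by rewrite lt_min a0.
move=> x; rewrite lt_min gt_max => K; rewrite fctE H ?H' ?addr0//.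
  by case: K => /andP[]; [left|right].
by case: K => /andP[]; [left|right].
Qed.

Lemma testfun_pd i f : testfun f -> testfun (pd i f).
Proof. by move=> [Cf Af]; split; [exact: Cinf_pd|exact: annular_pd]. Qed.

Lemma testfun_Ml f g : Cinf g -> testfun f -> testfun (g * f).
Proof. by move=> Cg [Cf Af]; split; [exact: Cinf_M|exact: annular_M]. Qed.

Lemma testfun_M f g : testfun g -> testfun f -> testfun (g * f).
Proof. by move=> [Cg _]; exact: testfun_Ml. Qed.

Lemma testfun_D f g : testfun f -> testfun g -> testfun (f + g).
Proof. by move=> [Cf Af] [Cg Ag]; split; [exact: Cinf_D|exact: annular_D]. Qed.

Lemma testfun_Z (c : R) f : testfun f -> testfun (c *: f).
Proof. by move=> Tf; rewrite scale_funE; apply: testfun_Ml => //; exact: Cinf_cst. Qed.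

Lemma testfun_N f : testfun f -> testfun (- f).
Proof. by rewrite -scaleN1r; exact: testfun_Z. Qed.

Lemma testfun_0 : testfun (0 : V -> R).
Proof. by split; [exact: Cinf_cst|exists 1, 1; split]. Qed.

Lemma testfun_sum (J : Type) (r : seq J) (F : J -> V -> R) :
  (forall k, testfun (F k)) -> testfun (\sum_(k <- r) F k).
Proof. by move=> TF; elim/big_ind : _ => //; [exact: testfun_0|exact: testfun_D]. Qed.

Lemma testfun_integ f : testfun f -> integ f.
Proof.
move=> [Cf [a [b [a0 H]]]]; apply: integ_continuous; first exact: Cinf_continuous.
by exists b => x xb; apply: H; right.
Qed.

Lemma testfun_Itg_pd i f : testfun f -> Itg (pd i f) = 0.
Proof.
move=> Tf; have [Cf [a [b [a0 H]]]] := Tf.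
have [Cpf [a' [b' [a0' H']]]] := testfun_pd i Tf.
apply: Itg_pd; try exact: Cinf_continuous.
- by exists b => x xb; apply: H; right.
- by move=> x; exact: Cinf_derivable.
- by exists b' => x xb; apply: H'; right.
Qed.

(* [w a x = |x|^(-2 a)] for [x != 0]; the value at [0] is irrelevant since [w a]
   only multiplies functions vanishing near [0]. *)
Definition w a x : R := sq x `^ (- a).

Lemma is_derive_w a i x : 0 < sq x ->
  is_derive x (evec i) (w a) (- (2 * a) * (x 0 i * w (a + 1) x)).
Proof.
move=> x0; have D1 : is_derive x (evec i) (@sq R n) (2 * x 0 i).
  have /derivableP := @Cinf_derivable R n (@sq R n) i x Cinf_sq.
  by rewrite -pdE pd_sq.
have := is_derive_comp1 D1 (is_derive1_powR (- a) x0).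
rewrite -[_ \o _]/(w a) /w opprD; move=> /is_derive_eq; apply.
ring.
Qed.

Lemma continuous_w a x : 0 < sq x -> {for x, continuous (w a)}.
Proof.
move=> x0; apply: (@continuous_comp _ _ _ (@sq R n) (fun y : R => y `^ (- a))).
  exact: continuous_sq.
apply/differentiable_continuous/derivable1_diffP.
by case: (is_derive1_powR (- a) x0).
Qed.

(** Where |x|^2 < a0 the product is locally zero, whatever [w a] does at the origin; elsewhere the
    product rule applies. *)
Lemma testfun_w_is_derive a i f x : testfun f -> is_derive x (evec i) (w a * f)
  ((w a * pd i f - (2 * a) *: (w (a + 1) * (coordf i * f))) x).
Proof.
move=> [Cf [a0 [b0 [a00 H]]]].
have [xa|xa] := ltP (sq x) a0.
  have N0 : \forall y \near x, f y = 0.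
    by apply: filterS (near_sq_lt xa) => y ya; apply: H; left.
  apply: (@near_eq_is_derive _ _ _ (cst 0)).
    by apply: filterS N0 => y fy; rewrite -[RHS]/(w a y * f y) fy mulr0.
  rewrite !fctE (pd_near0 i N0) (nbhs_singleton N0) !mulr0 scaler0 subr0.
  exact: is_derive_cst.
have x0 : 0 < sq x by rewrite (lt_le_trans a00).
have Df : is_derive x (evec i) f (pd i f x).
  by rewrite pdE; exact/derivableP/Cinf_derivable.
have := @is_deriveM _ _ _ _ _ _ _ _ (is_derive_w a i x0) Df.
move=> /is_derive_eq; apply; rewrite !fctE /GRing.scale/= /coordf; ring.
Qed.

Lemma pd_w a i f : testfun f ->
  pd i (w a * f) = w a * pd i f - (2 * a) *: (w (a + 1) * (coordf i * f)).
Proof.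
move=> Tf; apply/funext => x; rewrite pdE.
by case: (testfun_w_is_derive a i x Tf).
Qed.

Lemma annular_w a f : annular f -> annular (w a * f).
Proof. exact: annular_M. Qed.

Lemma Ck_w k a f : testfun f -> Ck k (w a * f).
Proof.
elim: k a f => [|k IHk] a f Tf.
  split=> // x; have [Cf [a0 [b0 [a00 H]]]] := Tf.
  have [xa|xa] := ltP (sq x) a0.
    have N0 : \forall y \near x, f y = 0.
      by apply: filterS (near_sq_lt xa) => y ya; apply: H; left.
    rewrite /continuous_at [X in _ --> X](_ : _ = 0); last first.
      by rewrite fctE (nbhs_singleton N0) mulr0.
    have N1 : \forall y \near x, (w a * f) y = 0.
      by apply: filterS N0 => y fy; rewrite -[LHS]/(w a y * f y) fy mulr0.
    exact: (@cvg_near_cst _ _ 0 (w a * f) (nbhs x) _ N1).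
  apply: continuousM; last exact: Cinf_continuous.
  by apply: continuous_w; exact: lt_le_trans xa.
split; first exact: Ck_continuous (IHk a f Tf).
move=> i; split; first by move=> x; case: (testfun_w_is_derive a i x Tf).
rewrite pd_w// -scaleNr; apply: Ck_D; first by apply: IHk; exact: testfun_pd.
rewrite scale_funE; apply: Ck_M; first exact: Ck_cst.
by apply: IHk; apply: testfun_Ml => //; exact: Cinf_coord.
Qed.

Lemma testfun_w a f : testfun f -> testfun (w a * f).
Proof. by move=> Tf; split=> [k|]; [exact: Ck_w|apply: annular_w; case: Tf]. Qed.

(** Identities between weights that hold only off the origin become identities of functions once
    multiplied by a test function. *)
Lemma testfun_eq f g h : testfun h -> (forall x, 0 < sq x -> f x = g x) ->
  f * h = g * h.
Proof.
move=> [_ [a [b [a0 H]]]] fg; apply/funext => x; rewrite !fctE.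
have [xa|xa] := ltP (sq x) a; first by rewrite H ?mulr0//; left.
by rewrite fg// (lt_le_trans a0).
Qed.

Lemma wMw a b f : testfun f -> w a * (w b * f) = w (a + b) * f.
Proof.
move=> Tf; rewrite mulrA; apply: testfun_eq => // x x0.
rewrite fctE /w opprD powRD//.
by apply/implyP => _; rewrite gt_eqF.
Qed.

Lemma wD a b x : 0 < sq x -> w (a + b) x = w a x * w b x.
Proof.
by move=> x0; rewrite /w opprD powRD//; apply/implyP => _; rewrite gt_eqF.
Qed.

Lemma w1E x : w 1 x = (sq x)^-1.
Proof. by rewrite /w powR_inv1// sq_ge0. Qed.

Lemma w_ge0 a x : 0 <= w a x.
Proof. exact: powR_ge0. Qed.

Lemma w1_sq f : testfun f -> w 1 * (sq * f) = f.
Proof.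
move=> Tf; rewrite mulrA -[RHS]mul1r; apply: testfun_eq => // x x0.
by rewrite fctE w1E mulVf// gt_eqF.
Qed.

End weights.

Ltac tst := repeat first
 [ assumption | apply: testfun_D | apply: testfun_N | apply: testfun_Z | apply: testfun_w
 | apply: testfun_pd | apply: testfun_sum => ? | (apply: testfun_Ml; [exact: Cinf_coord|])
 | (apply: testfun_Ml; [exact: Cinf_sq|]) | apply: testfun_M ].

(** * The Euler field and the rotation fields *)

HB.lock Definition rot {R : realType} {n : nat} (i j : 'I_n) (f : 'rV[R]_n -> R) :
  'rV[R]_n -> R := coordf i * pd j f - coordf j * pd i f.

Section operators.
Context {R : realType} {n : nat}.
Local Notation V := 'rV[R]_n.
Implicit Types (f g h : V -> R) (x : V) (i j k : 'I_n) (a b : R).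

Definition euler f : V -> R := \sum_i coordf i * pd i f.
Lemma rotE i j f : rot i j f = coordf i * pd j f - coordf j * pd i f.
Proof. by rewrite rot.unlock. Qed.

Lemma ptD f g x : (f + g) x = f x + g x. Proof. by []. Qed.
Lemma ptN f x : (- f) x = - f x. Proof. by []. Qed.
Lemma ptM f g x : (f * g) x = f x * g x. Proof. by []. Qed.
Lemma ptZ (c : R) f x : (c *: f) x = c * f x. Proof. by []. Qed.
Lemma pt0 x : (0 : V -> R) x = 0. Proof. by []. Qed.
Definition ptE := (ptD, ptN, ptM, ptZ, pt0).

Lemma fscalerAr (k : R) f g : k *: (f * g) = f * (k *: g).
Proof. by apply/funext => x; rewrite !ptE mulrCA. Qed.

Lemma fscalerAl (k : R) f g : k *: (f * g) = k *: f * g.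
Proof. by apply/funext => x; rewrite !ptE mulrA. Qed.

Lemma Cinf_euler f : Cinf f -> Cinf (euler f).
Proof.
move=> Cf; apply: Cinf_sum => i; apply: Cinf_M; first exact: Cinf_coord.
exact: Cinf_pd.
Qed.

Lemma testfun_euler f : testfun f -> testfun (euler f).
Proof. by move=> Tf; rewrite /euler; tst. Qed.

Lemma Cinf_rot i j f : Cinf f -> Cinf (rot i j f).
Proof.
move=> Cf; rewrite rotE; apply: Cinf_D; [|apply: Cinf_N]; apply: Cinf_M;
  by [exact: Cinf_coord|exact: Cinf_pd].
Qed.

Lemma testfun_rot i j f : testfun f -> testfun (rot i j f).
Proof. by move=> Tf; rewrite !rotE; tst. Qed.

Lemma CpdD i f g : Cinf f -> Cinf g -> pd i (f + g) = pd i f + pd i g.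
Proof. by move=> Cf Cg; apply: pdD => x; exact: Cinf_derivable. Qed.

Lemma CpdM i f g : Cinf f -> Cinf g -> pd i (f * g) = f * pd i g + g * pd i f.
Proof. by move=> Cf Cg; apply: pdM => x; exact: Cinf_derivable. Qed.

Lemma CpdN i f : Cinf f -> pd i (- f) = - pd i f.
Proof. by move=> Cf; rewrite -scaleN1r pdZ// scaleN1r. Qed.

Lemma euler_D f g : Cinf f -> Cinf g -> euler (f + g) = euler f + euler g.
Proof.
move=> Cf Cg; rewrite /euler -big_split/=; apply: eq_bigr => i _.
by rewrite CpdD// mulrDr.
Qed.

Lemma euler_Z c f : Cinf f -> euler (c *: f) = c *: euler f.
Proof.
move=> Cf; rewrite /euler scaler_sumr; apply: eq_bigr => i _.
by rewrite pdZ// fscalerAr.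
Qed.

Lemma euler_N f : Cinf f -> euler (- f) = - euler f.
Proof. by move=> Cf; rewrite -scaleN1r euler_Z// scaleN1r. Qed.

Lemma euler_M f g : Cinf f -> Cinf g -> euler (f * g) = f * euler g + g * euler f.
Proof.
move=> Cf Cg; rewrite /euler !mulr_sumr -big_split/=; apply: eq_bigr => i _.
by rewrite CpdM// mulrDr !(mulrCA (coordf i)).
Qed.

Lemma rot_D i j f g : Cinf f -> Cinf g -> rot i j (f + g) = rot i j f + rot i j g.
Proof. by move=> Cf Cg; rewrite !rotE !CpdD// !mulrDr opprD addrACA. Qed.

Lemma rot_Z i j c f : Cinf f -> rot i j (c *: f) = c *: rot i j f.
Proof. by move=> Cf; rewrite !rotE !pdZ// scalerBr !fscalerAr. Qed.

Lemma rot_M i j f g : Cinf f -> Cinf g -> rot i j (f * g) = f * rot i j g + g * rot i j f.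
Proof.
move=> Cf Cg; rewrite !rotE !CpdM// !mulrBr !mulrDr opprD addrACA.
by rewrite !(mulrCA (coordf _)).
Qed.

Lemma sum_coord_sq : \sum_i coordf i * coordf i = @sq R n.
Proof. by rewrite sq_funE. Qed.

Lemma euler_w a f : testfun f -> euler (w a * f) = w a * euler f - (2 * a) *: (w a * f).
Proof.
move=> Tf; rewrite /euler.
under eq_bigr do rewrite pd_w// mulrBr.
rewrite sumrB; congr (_ - _).
  by rewrite mulr_sumr; apply: eq_bigr => i _; rewrite mulrCA.
under eq_bigr do rewrite -fscalerAr mulrCA.
rewrite -scaler_sumr -mulr_sumr; congr (_ *: _).
under eq_bigr do rewrite mulrA.
rewrite -mulr_suml sum_coord_sq.
rewrite mulrA; apply: testfun_eq => // x x0.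
by rewrite !ptE wD// w1E mulfVK ?gt_eqF.
Qed.

Lemma rot_w i j a f : testfun f -> rot i j (w a * f) = w a * rot i j f.
Proof.
move=> Tf; rewrite !rotE !pd_w//; apply/funext => x.
rewrite !ptE.
move: (w a x) (w (a + 1) x) (pd i f x) (pd j f x) => ? ? ? ?; ring.
Qed.

Lemma pd_euler j f : Cinf f -> pd j (euler f) = pd j f + euler (pd j f).
Proof.
move=> Cf; rewrite /euler pd_sum; last first.
  by move=> i; apply: Cinf_M; [exact: Cinf_coord|exact: Cinf_pd].
rewrite (eq_bigr (fun i => coordf i * pd j (pd i f) + pd i f * cst (i == j)%:R)); last first.
  by move=> i _; rewrite CpdM ?pd_coord//; [exact: Cinf_coord|exact: Cinf_pd].
rewrite big_split/=.
have -> : \sum_i coordf i * pd j (pd i f) = \sum_i coordf i * pd i (pd j f).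
  by apply: eq_bigr => i _; rewrite (pd_comm i j Cf).
have -> : \sum_i pd i f * cst (i == j)%:R = pd j f.
  rewrite (bigD1 j)//= eqxx big1 ?addr0 => [|i ij].
    by apply/funext => x; rewrite !ptE /cst mulr1.
  by rewrite (negbTE ij); apply/funext => x; rewrite !ptE /cst mulr0.
by rewrite addrC.
Qed.

Lemma euler_coord i : euler (coordf i) = coordf i.
Proof.
rewrite /euler (bigD1 i)//= big1 ?addr0 => [|j ji]; rewrite pd_coord ?eqxx.
  by apply/funext => x; rewrite !ptE /cst mulr1.
rewrite eq_sym (negbTE ji).
by apply/funext => x; rewrite !ptE /cst mulr0.
Qed.

(** Multiplication by a coordinate raises the degree of homogeneity by 1 and a partial derivative
    lowers it by 1, so each [coordf k * pd l] commutes with the Euler field. *)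
Lemma rot_euler i j f : Cinf f -> rot i j (euler f) = euler (rot i j f).
Proof.
move=> Cf; rewrite !rotE !pd_euler//.
have Cm k l : Cinf (coordf k * pd l f).
  by apply: Cinf_M; [exact: Cinf_coord|exact: Cinf_pd].
have CE k l : euler (coordf k * pd l f) = coordf k * (pd l f + euler (pd l f)).
  rewrite euler_M ?euler_coord; [|exact: Cinf_coord|exact: Cinf_pd].
  by rewrite mulrDr addrC [pd l f * _]mulrC.
rewrite euler_D//; last exact: Cinf_N.
by rewrite euler_N// !CE.
Qed.

Lemma testfun_Itg_D f g : testfun f -> testfun g -> Itg (f + g) = Itg f + Itg g.
Proof. by move=> Tf Tg; apply: Itg_D; exact: testfun_integ. Qed.

Lemma testfun_Itg_Z c f : testfun f -> Itg (c *: f) = c * Itg f.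
Proof. by move=> Tf; apply: Itg_Z; exact: testfun_integ. Qed.

Lemma testfun_Itg_N f : testfun f -> Itg (- f) = - Itg f.
Proof. by move=> Tf; rewrite -scaleN1r testfun_Itg_Z// mulN1r. Qed.

Lemma testfun_Itg_sum (J : Type) (r : seq J) (F : J -> V -> R) :
  (forall p, testfun (F p)) -> Itg (\sum_(p <- r) F p) = \sum_(p <- r) Itg (F p).
Proof.
move=> TF; elim: r => [|c r IHr].
  rewrite !big_nil; have := testfun_Itg_Z 0 testfun_0; by rewrite scaler0 mul0r.
by rewrite !big_cons testfun_Itg_D ?IHr//; exact: testfun_sum.
Qed.

Lemma coord_pd i j f : testfun f ->
  coordf i * pd j f = pd j (coordf i * f) - (i == j)%:R *: f.
Proof.
move=> [Cf _]; rewrite CpdM ?pd_coord//; last exact: Cinf_coord.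
by rewrite scale_funE [X in _ + X - _]mulrC addrK.
Qed.

Lemma testfun_Itg_coord_pd i j f : testfun f -> Itg (coordf i * pd j f) = - (i == j)%:R * Itg f.
Proof.
move=> Tf; rewrite coord_pd// testfun_Itg_D; [|tst|tst].
by rewrite testfun_Itg_pd ?testfun_Itg_N ?testfun_Itg_Z//; tst; rewrite add0r mulNr.
Qed.

Lemma testfun_Itg_euler f : testfun f -> Itg (euler f) = - n%:R * Itg f.
Proof.
move=> Tf; rewrite /euler testfun_Itg_sum; last by move=> i; tst.
under eq_bigr do rewrite testfun_Itg_coord_pd// eqxx.
by rewrite sumr_const card_ord !mulNr mul1r mulNrn mulr_natl.
Qed.

Lemma testfun_Itg_rot i j f : testfun f -> Itg (rot i j f) = 0.
Proof.
by move=> Tf; rewrite !rotE testfun_Itg_D ?testfun_Itg_N ?testfun_Itg_coord_pd//; tst; rewrite eq_sym subrr.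
Qed.

(* The scalar product of [L^2(|x|^-4 dx)]. *)
Definition br g h : R := Itg (w 2 * (g * h)).

Lemma brC g h : br g h = br h g.
Proof. by rewrite /br [g * h]mulrC. Qed.

Lemma brDl f g h : testfun f -> testfun g -> testfun h -> br (f + g) h = br f h + br g h.
Proof. by move=> Tf Tg Th; rewrite /br mulrDl mulrDr testfun_Itg_D//; tst. Qed.

Lemma brZl c f g : testfun f -> testfun g -> br (c *: f) g = c * br f g.
Proof. by move=> Tf Tg; rewrite /br -fscalerAl -fscalerAr testfun_Itg_Z//; tst. Qed.

Lemma brDr f g h : testfun f -> testfun g -> testfun h -> br h (f + g) = br h f + br h g.
Proof. by move=> Tf Tg Th; rewrite brC brDl// ![br h _]brC. Qed.

Lemma brZr c f g : testfun f -> testfun g -> br g (c *: f) = c * br g f.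
Proof. by move=> Tf Tg; rewrite brC brZl// brC. Qed.

Lemma brNl f g : testfun f -> testfun g -> br (- f) g = - br f g.
Proof. by move=> Tf Tg; rewrite -scaleN1r brZl// mulN1r. Qed.

Lemma br_suml (J : Type) (r : seq J) (F : J -> V -> R) g :
  (forall p, testfun (F p)) -> testfun g ->
  br (\sum_(p <- r) F p) g = \sum_(p <- r) br (F p) g.
Proof.
by move=> TF Tg; rewrite /br mulr_suml mulr_sumr testfun_Itg_sum// => k; tst.
Qed.

Lemma br_ge0 g : 0 <= br g g.
Proof.
by apply: Itg_ge0 => x; rewrite !ptE mulr_ge0 ?w_ge0// -expr2 sqr_ge0.
Qed.

(** The integral of E (|x|^-4 g h) is computed in two ways: the divergence of the Euler field gives
    n, the degree of the weight gives -4. Half of the defect n - 4 is the shift that makes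
    [skew_euler] antisymmetric. *)
Lemma br_euler g h : testfun g -> testfun h ->
  br (euler g) h = - br g (euler h) - (n%:R - 4) * br g h.
Proof.
move=> Tg Th; have Tgh : testfun (g * h) by tst.
have TEg := testfun_euler Tg; have TEh := testfun_euler Th.
have : Itg (euler (w 2 * (g * h))) = - n%:R * br g h by rewrite testfun_Itg_euler//; tst.
have [Cg _] := Tg; have [Ch _] := Th.
rewrite euler_w// euler_M// mulrDr testfun_Itg_D; [|tst|tst].
rewrite testfun_Itg_D; [|tst|tst]; rewrite testfun_Itg_N; last by tst.
rewrite testfun_Itg_Z; last by tst.
rewrite -/(br g h) -/(br g (euler h)) -/(br h (euler g)) [br h (euler g)]brC.
move: (br _ _) (br _ _) (br _ _) => u v t; lra.
Qed.

Lemma br_rot i j g h : testfun g -> testfun h -> br (rot i j g) h = - br g (rot i j h).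
Proof.
move=> Tg Th; have Tgh : testfun (g * h) by tst.
have TEg := testfun_rot i j Tg; have TEh := testfun_rot i j Th.
have : Itg (rot i j (w 2 * (g * h))) = 0 by rewrite testfun_Itg_rot//; tst.
have [Cg _] := Tg; have [Ch _] := Th.
rewrite rot_w// rot_M// mulrDr testfun_Itg_D; [|tst|tst].
rewrite -/(br g (rot i j h)) -/(br h (rot i j g)) [br h (rot i j g)]brC.
move: (br _ _) (br _ _) => u v; lra.
Qed.

(** * The radial Laplacian as a polynomial in an antisymmetric operator *)

Definition skew_euler f : V -> R := euler f + ((n%:R - 4) / 2) *: f.

(* [|x|^2] times the radial Laplacian. *)
Definition rad_lap f : V -> R := euler (euler f) + (n%:R - 2) *: euler f.

Lemma testfun_skew_euler f : testfun f -> testfun (skew_euler f).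
Proof. by move=> Tf; rewrite /skew_euler; have TE := testfun_euler Tf; tst. Qed.

Lemma testfun_rad_lap f : testfun f -> testfun (rad_lap f).
Proof.
by move=> Tf; have T1 := testfun_euler Tf; have T2 := testfun_euler T1; rewrite /rad_lap; tst.
Qed.

Lemma br_skew_euler g h : testfun g -> testfun h -> br (skew_euler g) h = - br g (skew_euler h).
Proof.
move=> Tg Th; have TEg := testfun_euler Tg; have TEh := testfun_euler Th.
rewrite /skew_euler brDl//; last by tst.
rewrite brDr//; last by tst.
rewrite brZl// brZr// br_euler//.
move: (br _ _) (br _ _) => u v; lra.
Qed.

Local Notation c := (rellich_const R n).

Lemma rad_lap_skew_euler f : testfun f -> rad_lap f = skew_euler (skew_euler f) + 2 *: skew_euler f - c *: f.
Proof.
move=> [Cf _]; have CE := Cinf_euler Cf.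
rewrite /rad_lap /skew_euler euler_D//; last exact: Cinf_Z.
rewrite euler_Z// /rellich_const.
apply/funext => x; rewrite !ptE.
by move: (euler (euler f) x) (euler f x) (f x) => u v t; field.
Qed.

Lemma br_sq3 f g h (k l : R) : testfun f -> testfun g -> testfun h ->
  br (f + k *: g + l *: h) (f + k *: g + l *: h) =
  br f f + k ^+ 2 * br g g + l ^+ 2 * br h h +
  2 * k * br f g + 2 * l * br f h + 2 * k * l * br g h.
Proof.
move=> Tf Tg Th; have T1 : testfun (k *: g) by tst.
have T2 : testfun (l *: h) by tst.
have T3 : testfun (f + k *: g) by tst.
have T4 : testfun (f + k *: g + l *: h) by tst.
rewrite (brDl T3 T2 T4) (brDl Tf T1 T4).
rewrite (brDr T3 T2 Tf) (brDr T3 T2 T1) (brDr T3 T2 T2).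
rewrite (brDr Tf T1 Tf) (brDr Tf T1 T1) (brDr Tf T1 T2).
rewrite !(brZl _ _ _) ?(brZr _ _ _)//.
rewrite [br g f]brC [br h f]brC [br h g]brC.
move: (br _ _) (br _ _) (br _ _) (br _ _) (br _ _) (br _ _) => *; ring.
Qed.

(** By antisymmetry A^2 f is orthogonal to A f and A f to f, while <A^2 f, f> = - |A f|^2. The
    coefficient of |A f|^2 thus collects 4 from the square of 2 A f and 2 c from the product of A^2
    f with - c f. *)
Lemma br_rad_lap f : testfun f -> br (rad_lap f) (rad_lap f) =
  br (skew_euler (skew_euler f)) (skew_euler (skew_euler f)) + (2 * c + 4) * br (skew_euler f) (skew_euler f) + c ^+ 2 * br f f.
Proof.
move=> Tf; have TA := testfun_skew_euler Tf; have TAA := testfun_skew_euler TA.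
rewrite rad_lap_skew_euler// -scaleNr br_sq3//.
have e1 : br (skew_euler (skew_euler f)) (skew_euler f) = 0.
  by have := br_skew_euler TA TA; rewrite [X in _ = - X]brC; move: (br _ _) => u; lra.
have e2 : br (skew_euler f) f = 0.
  by have := br_skew_euler Tf Tf; rewrite [X in _ = - X]brC; move: (br _ _) => u; lra.
have e3 : br (skew_euler (skew_euler f)) f = - br (skew_euler f) (skew_euler f) by rewrite br_skew_euler.
rewrite e1 e2 e3.
move: (br _ _) (br _ _) (br _ _) c => u v t d; ring.
Qed.

Lemma br_rad_lapr g : testfun g -> br g (rad_lap g) = - br (skew_euler g) (skew_euler g) - c * br g g.
Proof.
move=> Tf; have TA := testfun_skew_euler Tf; have TAA := testfun_skew_euler TA.
rewrite rad_lap_skew_euler//.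
have T1 : testfun (2 *: skew_euler g) by tst.
have T2 : testfun (- c *: g) by tst.
have T3 : testfun (skew_euler (skew_euler g) + 2 *: skew_euler g) by tst.
rewrite -scaleNr brDr// brDr// !brZr//.
have e2 : br (skew_euler g) g = 0.
  by have := br_skew_euler Tf Tf; rewrite [X in _ = - X]brC; move: (br _ _) => u; lra.
have e3 : br (skew_euler (skew_euler g)) g = - br (skew_euler g) (skew_euler g) by rewrite br_skew_euler.
by rewrite [br g (skew_euler (skew_euler g))]brC [br g (skew_euler g)]brC e2 e3 mulr0 addr0 mulNr.
Qed.

(** 2 c + 4 = ((n - 2)^2 + 4) / 2. *)
Lemma rellich_const_gt : 0 < 2 * c + 4.
Proof.
rewrite /rellich_const; move: (n%:R : R) => m.
have : 0 <= (m - 2) ^+ 2 by exact: sqr_ge0.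
nra.
Qed.

Theorem br_rellich f : testfun f -> c ^+ 2 * br f f <= br (rad_lap f) (rad_lap f).
Proof.
move=> Tf; rewrite br_rad_lap// lerDr addr_ge0 ?br_ge0//.
by rewrite mulr_ge0 ?br_ge0// ltW// rellich_const_gt.
Qed.

(** * Rotations and the spherical Laplacian *)

Lemma rot_rad_lap i j f : testfun f -> rot i j (rad_lap f) = rad_lap (rot i j f).
Proof.
move=> [Cf _]; have C1 := Cinf_euler Cf; have C2 := Cinf_euler C1.
rewrite /rad_lap rot_D ?rot_Z//; last exact: Cinf_Z.
by rewrite !rot_euler.
Qed.

Lemma br_rot2_rad_lap i j f : testfun f -> br (rot i j (rot i j f)) (rad_lap f) =
  br (skew_euler (rot i j f)) (skew_euler (rot i j f)) + c * br (rot i j f) (rot i j f).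
Proof.
move=> Tf; have TL := testfun_rot i j Tf.
rewrite br_rot//; last exact: testfun_rad_lap.
rewrite rot_rad_lap// br_rad_lapr// opprD !opprK//.
Qed.

(* The Laplacian of the sphere. *)
Definition sph_lap f : V -> R := 2^-1 *: \sum_i \sum_j rot i j (rot i j f).

Lemma testfun_sph_lap f : testfun f -> testfun (sph_lap f).
Proof.
move=> Tf; rewrite /sph_lap; apply: testfun_Z; apply: testfun_sum => i; apply: testfun_sum => j.
by do 2 apply: testfun_rot.
Qed.

Lemma br_sph_lap_rad_lap f : testfun f -> br (sph_lap f) (rad_lap f) >=
  c * (2^-1 * \sum_i \sum_j br (rot i j f) (rot i j f)).
Proof.
move=> Tf; have TQ := testfun_rad_lap Tf.
have TLL i j : testfun (rot i j (rot i j f)) by do 2 apply: testfun_rot.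
rewrite /sph_lap brZl//; last by apply: testfun_sum => i; exact: testfun_sum.
rewrite br_suml//; last by move=> i; exact: testfun_sum.
rewrite mulrCA ler_pM2l ?invr_gt0// mulr_sumr; apply: ler_sum => i _.
rewrite br_suml// mulr_sumr; apply: ler_sum => j _.
(* The nonnegative term |A L_ij f|^2 is dropped. *)
by rewrite br_rot2_rad_lap// lerDr br_ge0.
Qed.

Definition lap f : V -> R := \sum_i pd i (pd i f).

Lemma euler_euler f : Cinf f ->
  euler (euler f) = euler f + \sum_i \sum_j coordf i * (coordf j * pd i (pd j f)).
Proof.
move=> Cf; rewrite {1}/euler.
under eq_bigr => i _.
  rewrite /euler pd_sum; last by move=> j; apply: Cinf_M; [exact: Cinf_coord|exact: Cinf_pd].
  rewrite (eq_bigr (fun j => coordf j * pd i (pd j f) + (j == i)%:R *: pd j f)); last first.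
    move=> j _; rewrite CpdM ?pd_coord; [|exact: Cinf_coord|exact: Cinf_pd].
    by rewrite scale_funE [pd j f * _]mulrC.
  have -> : \sum_j (coordf j * pd i (pd j f) + (j == i)%:R *: pd j f) =
      \sum_j coordf j * pd i (pd j f) + pd i f.
    rewrite big_split/=; congr (_ + _).
    rewrite (bigD1 i)//= eqxx scale1r big1 ?addr0// => j ji.
    by rewrite (negbTE ji) scale0r.
  rewrite mulrDr mulr_sumr.
over.
by rewrite big_split/= addrC.
Qed.

(** Lagrange's identity for x and the gradient: half the sum of the L_ij^2 over all ordered pairs is
    s Delta - (E^2 - E) + E - n E. Here E^2 - E is the Hessian contracted twice with x, and the
    first order terms come from derivatives falling on coordinates. *)
Lemma sq_lap f : Cinf f -> sq * lap f = rad_lap f + sph_lap f.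
Proof.
move=> Cf; have Cp i := Cinf_pd i Cf.
have Cm i j : Cinf (coordf i * pd j f) by apply: Cinf_M => //; exact: Cinf_coord.
pose H i j : V -> R := pd i (pd j f).
have pdm i j k : pd k (coordf i * pd j f) = coordf i * H k j + (i == k)%:R *: pd j f.
  rewrite CpdM ?pd_coord//; last exact: Cinf_coord.
  by rewrite scale_funE [pd j f * _]mulrC.
(* The Kronecker term makes the formula valid on the diagonal, where L_ii = 0, so that the double
   sums may run over all pairs. *)
have LL i j : rot i j (rot i j f) =
    (coordf i * coordf i * H j j + coordf j * coordf j * H i i)
    - (coordf i * coordf j * H j i + coordf j * coordf i * H i j)
    + (2 * (i == j)%:R) *: (coordf i * pd j f)
    - (coordf i * pd i f + coordf j * pd j f).
  rewrite !rotE !CpdD//; try exact: Cinf_N.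
  rewrite !CpdN// !pdm !eqxx [j == i]eq_sym.
  have [->|_] := eqVneq i j; apply/funext => x;
    rewrite !ptE /H ?mulr1n ?mulr0n; ring.
rewrite /sph_lap; under eq_bigr do under eq_bigr do rewrite LL.
under eq_bigr do rewrite !big_split/= !sumrN !big_split/=.
rewrite !big_split/= !sumrN !big_split/=.
have S1 : \sum_i \sum_j coordf i * coordf i * H j j = sq * lap f.
  rewrite -sum_coord_sq mulr_suml; apply: eq_bigr => i _.
  by rewrite /lap mulr_sumr.
have S2 : \sum_i \sum_j coordf j * coordf j * H i i = sq * lap f.
  by rewrite exchange_big/= S1.
have S3 : \sum_i \sum_j coordf j * coordf i * H i j = euler (euler f) - euler f.
  rewrite euler_euler// addrC addKr.
  by apply: eq_bigr => i _; apply: eq_bigr => j _; rewrite mulrA [coordf j * _]mulrC.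
have S4 : \sum_i \sum_j coordf i * coordf j * H j i = euler (euler f) - euler f.
  by rewrite exchange_big/= S3.
have S5 : \sum_i \sum_j (2 * (i == j)%:R) *: (coordf i * pd j f) = 2 *: euler f.
  rewrite /euler scaler_sumr; apply: eq_bigr => i _.
  rewrite (bigD1 i)//= eqxx mulr1 big1 ?addr0// => j ji.
  by rewrite eq_sym (negbTE ji) mulr0 scale0r.
have S6 : \sum_(i < n) \sum_j (coordf j * pd j f) = n%:R *: euler f.
  by rewrite sumr_const card_ord scaler_nat.
have S7 : \sum_i \sum_(j < n) (coordf i * pd i f) = n%:R *: euler f.
  by rewrite exchange_big/= S6.
rewrite S1 S2 S3 S4 S5 S6 S7 /rad_lap.
apply/funext => x; rewrite !ptE.
move: (euler (euler f) x) (euler f x) (lap f x) (sq x) => u v t s; by field.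
Qed.

Theorem br_lap_ge4 f : (4 <= n)%N -> testfun f ->
  br (rad_lap f) (rad_lap f) <= br (rad_lap f + sph_lap f) (rad_lap f + sph_lap f).
Proof.
move=> n4 Tf; have TQ := testfun_rad_lap Tf; have TD := testfun_sph_lap Tf.
have TQD : testfun (rad_lap f + sph_lap f) by tst.
rewrite (brDl TQ TD TQD) (brDr TQ TD TQ) (brDr TQ TD TD) [br (rad_lap f) (sph_lap f)]brC.
rewrite -addrA lerDl.
have c0 : 0 <= c.
  rewrite /rellich_const divr_ge0// mulr_ge0// subr_ge0.
  by rewrite (ler_nat R 4 n).
have := br_sph_lap_rad_lap Tf; have := br_ge0 (sph_lap f).
have : 0 <= c * (2^-1 * \sum_i \sum_j br (rot i j f) (rot i j f)).
  apply: mulr_ge0 => //; apply: mulr_ge0; first by rewrite invr_ge0.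
  apply: sumr_ge0 => i _.
  by apply: sumr_ge0 => j _; exact: br_ge0.
move: (br _ _) (br _ _) (c * _) => u v t; lra.
Qed.

End operators.

Ltac tst ::= repeat first
 [ assumption | apply: testfun_D | apply: testfun_N | apply: testfun_Z | apply: testfun_w
 | apply: testfun_pd | apply: testfun_rot | apply: testfun_euler | apply: testfun_skew_euler | apply: testfun_rad_lap
 | apply: testfun_sph_lap | apply: testfun_sum => ? | (apply: testfun_Ml; [exact: Cinf_coord|])
 | (apply: testfun_Ml; [exact: Cinf_sq|]) | apply: testfun_M ].

(** * The spectral gap in dimension three *)

Section commutators.
Context {R : realType} {n : nat}.
Local Notation V := 'rV[R]_n.
Implicit Types (f g h : V -> R) (x : V) (i j k : 'I_n).

(** Commutation relations of the Lie algebra so(n); the second order terms cancel by [pd_comm]. *)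
Lemma rot_comm i j k f : i != j -> j != k -> i != k -> Cinf f ->
  rot i j (rot j k f) = rot j k (rot i j f) + rot i k f.
Proof.
move=> ij jk ik Cf; have Cp a := Cinf_pd a Cf.
have Cm a b : Cinf (coordf a * pd b f) by apply: Cinf_M => //; exact: Cinf_coord.
have pdm a b d : pd d (coordf a * pd b f) =
    coordf a * pd d (pd b f) + (a == d)%:R *: pd b f.
  rewrite CpdM ?pd_coord//; last exact: Cinf_coord.
  by rewrite scale_funE [pd b f * _]mulrC.
rewrite !rotE !CpdD//; try exact: Cinf_N.
rewrite !CpdN// !pdm !eqxx (negbTE ij) [j == i]eq_sym (negbTE ij).
rewrite (negbTE jk) [k == j]eq_sym (negbTE jk) (negbTE ik) [k == i]eq_sym (negbTE ik).
rewrite !scale0r !scale1r !addr0 [pd k (pd j f)](pd_comm _ _ Cf).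
rewrite [pd k (pd i f)](pd_comm _ _ Cf) [pd j (pd i f)](pd_comm _ _ Cf).
apply/funext => x; rewrite !ptE.
move: (pd j (pd j f) x) (pd i (pd k f) x) (pd j (pd k f) x) (pd i (pd j f) x).
move: (pd i f x) (pd k f x) (pd j f x) => *; ring.
Qed.

Lemma rot_anti i j f : rot j i f = - rot i j f.
Proof. by rewrite !rotE opprB. Qed.

Lemma rot_N i j f : Cinf f -> rot i j (- f) = - rot i j f.
Proof. by move=> Cf; rewrite -scaleN1r rot_Z// scaleN1r. Qed.

Lemma rot_coord i j k : rot i j (coordf k : V -> R) =
  (k == j)%:R *: coordf i - (k == i)%:R *: coordf j.
Proof. by rewrite !rotE !pd_coord !scale_funE ![_ * coordf _]mulrC. Qed.

(** The sum of the three squares is the Casimir element of so(3), hence central. Moving L_jk through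
    L_ki^2 and L_ij^2 produces the symmetrized product of L_ki and L_ij twice, with opposite
    signs. *)
Lemma rot_casimir i j k f : i != j -> j != k -> i != k -> Cinf f ->
  rot j k (rot j k (rot j k f) + rot k i (rot k i f) + rot i j (rot i j f)) =
  rot j k (rot j k (rot j k f)) + rot k i (rot k i (rot j k f)) + rot i j (rot i j (rot j k f)).
Proof.
move=> ij jk ik Cf; have [ji kj ki] : [/\ j != i, k != j & k != i].
  by rewrite [j == i]eq_sym [k == j]eq_sym [k == i]eq_sym.
have C1 a b g : Cinf g -> Cinf (rot a b g) by exact: Cinf_rot.
have ab g : Cinf g -> rot j k (rot k i g) = rot k i (rot j k g) - rot i j g.
  by move=> Cg; rewrite rot_comm// (rot_anti i j).
have ca g : Cinf g -> rot j k (rot i j g) = rot i j (rot j k g) + rot k i g.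
  by move=> Cg; rewrite (rot_comm ij jk ik Cg) (rot_anti k i) addrNK.
rewrite !rot_D//; try by apply: Cinf_D; do 2 apply: Cinf_rot.
  rewrite -!addrA; congr (_ + _).
  rewrite (ab _ (C1 _ _ _ Cf)) (ab _ Cf) (ca _ (C1 _ _ _ Cf)) (ca _ Cf).
  have C2 a b : Cinf (rot a b f) by exact: C1.
  have C3 a b c d : Cinf (rot a b (rot c d f)) by do 2 apply: Cinf_rot.
  rewrite rot_D//; last exact: Cinf_N.
  rewrite rot_N// rot_D//.
  by apply/funext => x; rewrite !ptE; ring.
all: by do 2 apply: Cinf_rot.
Qed.

End commutators.

Section dimension3.
Context {R : realType}.
Local Notation V := 'rV[R]_3.
Implicit Types (f g h : V -> R) (x : V).

Let i0 : 'I_3 := Ordinal (isT : 0 < 3)%N.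
Let i1 : 'I_3 := Ordinal (isT : 1 < 3)%N.
Let i2 : 'I_3 := Ordinal (isT : 2 < 3)%N.

Lemma sum_ord3 (T : nmodType) (F : 'I_3 -> T) : \sum_i F i = F i0 + F i1 + F i2.
Proof.
rewrite !big_ord_recr big_ord0/= add0r; congr (F _ + F _ + F _); exact: val_inj.
Qed.

(** The three components of the cross product of x with the gradient. *)
Local Notation La := (rot i1 i2).
Local Notation Lb := (rot i2 i0).
Local Notation Lc := (rot i0 i1).

Lemma sph_lap_dim3 f : Cinf f -> sph_lap f = La (La f) + Lb (Lb f) + Lc (Lc f).
Proof.
move=> Cf; rewrite /sph_lap !sum_ord3.
have Lii i : rot i i (rot i i f) = 0 by rewrite rotE subrr.
have LL i j : rot j i (rot j i f) = rot i j (rot i j f).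
  by rewrite !(rot_anti i j) rot_N ?opprK//; exact: Cinf_rot.
rewrite !Lii (LL i0 i1) (LL i1 i2) (LL i2 i0).
move: (rot _ _ _) (rot _ _ _) (rot _ _ _) => u v t.
by apply/funext => x; rewrite !ptE; field.
Qed.

Lemma coord_rot_dim3 f : coordf i0 * La f + coordf i1 * Lb f + coordf i2 * Lc f = 0.
Proof.
apply/funext => x; rewrite !rotE !ptE; move: (pd _ _ _) (pd _ _ _) (pd _ _ _).
by move=> u v t; ring.
Qed.

(* With [v = m x], [t = tr m] and [s = |x|^2], the inequality is the
   nonnegativity of the squared norm of
   [s m - v x^T - (t / 2) (s 1 - x x^T)]. *)
Lemma tangent_hessian_ineq (s x0 x1 x2 l0 l1 l2 m00 m01 m02 m10 m11 m12 m20 m21 m22 : R) :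
  x0 * m00 + x1 * m10 + x2 * m20 = 0 ->
  x0 * m01 + x1 * m11 + x2 * m21 = 0 ->
  x0 * m02 + x1 * m12 + x2 * m22 = 0 ->
  x0 * m00 + x1 * m01 + x2 * m02 = x2 * l1 - x1 * l2 ->
  x0 * m10 + x1 * m11 + x2 * m12 = x0 * l2 - x2 * l0 ->
  x0 * m20 + x1 * m21 + x2 * m22 = x1 * l0 - x0 * l1 ->
  x0 * l0 + x1 * l1 + x2 * l2 = 0 ->
  s = x0 ^+ 2 + x1 ^+ 2 + x2 ^+ 2 ->
  s ^+ 2 * (l0 ^+ 2 + l1 ^+ 2 + l2 ^+ 2 + (m00 + m11 + m22) ^+ 2 / 2) <=
  s ^+ 2 * (m00 ^+ 2 + m01 ^+ 2 + m02 ^+ 2 + m10 ^+ 2 + m11 ^+ 2 + m12 ^+ 2 + m20 ^+ 2 + m21 ^+ 2 + m22 ^+ 2).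
Proof.
move=> c0 c1 c2 r0 r1 r2 xl sE.
pose v0 := x0 * m00 + x1 * m01 + x2 * m02.
pose v1 := x0 * m10 + x1 * m11 + x2 * m12.
pose v2 := x0 * m20 + x1 * m21 + x2 * m22.
pose t := m00 + m11 + m22.
pose e := x0 * v0 + x1 * v1 + x2 * v2.
(* [e] is the quadratic form x^T m x, and x^T m = 0 by the first three hypotheses. *)
have e0 : e = 0.
  rewrite (_ : e = x0 * (x0 * m00 + x1 * m10 + x2 * m20) +
    x1 * (x0 * m01 + x1 * m11 + x2 * m21) +
    x2 * (x0 * m02 + x1 * m12 + x2 * m22)).
    by rewrite c0 c1 c2 !mulr0 !addr0.
  by rewrite /e /v0 /v1 /v2; ring.
(* [v] is the cross product of l and x, and l is orthogonal to x. *)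
have v2E : v0 ^+ 2 + v1 ^+ 2 + v2 ^+ 2 = s * (l0 ^+ 2 + l1 ^+ 2 + l2 ^+ 2).
  rewrite (_ : s * _ = (x2 * l1 - x1 * l2) ^+ 2 + (x0 * l2 - x2 * l0) ^+ 2 +
    (x1 * l0 - x0 * l1) ^+ 2 + (x0 * l0 + x1 * l1 + x2 * l2) ^+ 2).
    by rewrite xl expr0n addr0 -r0 -r1 -r2.
  by rewrite sE; ring.
have KE : (s * m00 - v0 * x0 - t / 2 * (s - x0 * x0)) ^+ 2 +
    (s * m01 - v0 * x1 - t / 2 * (0 - x0 * x1)) ^+ 2 +
    (s * m02 - v0 * x2 - t / 2 * (0 - x0 * x2)) ^+ 2 +
    (s * m10 - v1 * x0 - t / 2 * (0 - x1 * x0)) ^+ 2 +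
    (s * m11 - v1 * x1 - t / 2 * (s - x1 * x1)) ^+ 2 +
    (s * m12 - v1 * x2 - t / 2 * (0 - x1 * x2)) ^+ 2 +
    (s * m20 - v2 * x0 - t / 2 * (0 - x2 * x0)) ^+ 2 +
    (s * m21 - v2 * x1 - t / 2 * (0 - x2 * x1)) ^+ 2 +
    (s * m22 - v2 * x2 - t / 2 * (s - x2 * x2)) ^+ 2 =
    s ^+ 2 * (m00 ^+ 2 + m01 ^+ 2 + m02 ^+ 2 + m10 ^+ 2 + m11 ^+ 2 + m12 ^+ 2 + m20 ^+ 2 + m21 ^+ 2 + m22 ^+ 2)
    - s * (v0 ^+ 2 + v1 ^+ 2 + v2 ^+ 2) - s ^+ 2 * (t ^+ 2 / 2) + s * t * e.
  by rewrite /e /t /v0 /v1 /v2 sE; field.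
rewrite -subr_ge0; move: KE; rewrite e0 mulr0 addr0 v2E => KE.
rewrite (_ : _ - _ = s ^+ 2 * (m00 ^+ 2 + m01 ^+ 2 + m02 ^+ 2 + m10 ^+ 2 + m11 ^+ 2 + m12 ^+ 2 + m20 ^+ 2 + m21 ^+ 2 + m22 ^+ 2)
    - s * (s * (l0 ^+ 2 + l1 ^+ 2 + l2 ^+ 2)) - s ^+ 2 * (t ^+ 2 / 2)).
  by rewrite -KE !addr_ge0// sqr_ge0.
by rewrite /t; ring.
Qed.

(** Leibniz rule applied to [coord_rot_dim3]. It gives the product with x of the matrix of second
    rotational derivatives in terms of first derivatives only. *)
Lemma coord_rot2_dim3 i j f : Cinf f ->
  coordf i0 * rot i j (La f) + coordf i1 * rot i j (Lb f) + coordf i2 * rot i j (Lc f)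
  = - (La f * rot i j (coordf i0) + Lb f * rot i j (coordf i1)
       + Lc f * rot i j (coordf i2)).
Proof.
move=> Cf; have C1 a b : Cinf (rot a b f) by exact: Cinf_rot.
have Cc a : Cinf (coordf a : V -> R) by exact: Cinf_coord.
have : rot i j (coordf i0 * La f + coordf i1 * Lb f + coordf i2 * Lc f) = 0.
  by rewrite coord_rot_dim3 -(scale0r (0 : V -> R)) rot_Z ?scale0r//; exact: Cinf_cst.
rewrite rot_D; [|by apply: Cinf_D; exact: Cinf_M|exact: Cinf_M].
rewrite rot_D; [|exact: Cinf_M|exact: Cinf_M].
rewrite !rot_M// => H; apply/eqP; rewrite -subr_eq0 opprK -H; apply/eqP.
apply/funext => x; rewrite !ptE; ring.
Qed.

(** Let m be the matrix of the L_p L_q f, with p, q among the three fields, and S the sum of the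
    three |L_q f|^2. Since D commutes with each L_q, the integral of |m|^2 against the weight is the
    sum of the <D f, L_q^2 f>, that is |D f|^2. The trace of m is D f, so [tangent_hessian_ineq]
    integrates to |D f|^2 >= S + |D f|^2 / 2, or |D f|^2 >= 2 S. The sum over all ordered pairs
    equals 2 S; the factor 2 is the first nonzero eigenvalue of the sphere. *)
Lemma br_lich f : testfun f ->
  \sum_i \sum_j br (rot i j f) (rot i j f) <= br (sph_lap f) (sph_lap f).
Proof.
move=> Tf; have [Cf Af] := Tf.
have TL i j g : testfun g -> testfun (rot i j g) by exact: testfun_rot.
have TLL i j k l : testfun (rot i j (rot k l f)) by do 2 apply: testfun_rot.
have TD := testfun_sph_lap Tf.
pose S := br (La f) (La f) + br (Lb f) (Lb f) + br (Lc f) (Lc f).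
have -> : \sum_i \sum_j br (rot i j f) (rot i j f) = 2 * S.
  have Lii i : br (rot i i f) (rot i i f) = 0.
    by rewrite rotE subrr -(scale0r f) brZl ?mul0r//; tst.
  have LL i j : br (rot j i f) (rot j i f) = br (rot i j f) (rot i j f).
    have TLij := testfun_rot i j Tf.
    by rewrite (rot_anti i j) brNl ?[br _ (- _)]brC ?brNl ?opprK//; tst.
  rewrite !sum_ord3 !Lii (LL i0 i1) (LL i1 i2) (LL i2 i0) /S.
  move: (br _ _) (br _ _) (br _ _) => *; ring.
have DL i j k (g : V -> R) : i != j -> j != k -> i != k -> testfun g ->
    br (rot j k (rot j k g)) g = - br (rot j k g) (rot j k g).
  by move=> _ _ _ Tg; rewrite br_rot//; exact: TL.
have brLD p q : rot p q (sph_lap f) = sph_lap (rot p q f) ->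
    br (sph_lap f) (rot p q (rot p q f)) =
    br (La (rot p q f)) (La (rot p q f)) + br (Lb (rot p q f)) (Lb (rot p q f))
      + br (Lc (rot p q f)) (Lc (rot p q f)).
  move=> H; rewrite brC br_rot//; last exact: TL.
  rewrite H sph_lap_dim3; last exact: Cinf_rot.
  have TLp := TL p q f Tf.
  have Ta := TL i1 i2 _ TLp; have Tb := TL i2 i0 _ TLp; have Tc := TL i0 i1 _ TLp.
  have Taa := TL i1 i2 _ Ta; have Tbb := TL i2 i0 _ Tb; have Tcc := TL i0 i1 _ Tc.
  rewrite brC (brDl (testfun_D Taa Tbb) Tcc TLp) (brDl Taa Tbb TLp).
  by rewrite !br_rot// -!opprD opprK.
have Ca : La (sph_lap f) = sph_lap (La f).
  rewrite !sph_lap_dim3//; last exact: Cinf_rot.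
  by apply: rot_casimir.
have Cb : Lb (sph_lap f) = sph_lap (Lb f).
  rewrite !sph_lap_dim3//; last exact: Cinf_rot.
  rewrite [X in rot _ _ X](_ : _ = Lb (Lb f) + Lc (Lc f) + La (La f)); last first.
    by rewrite [RHS]addrC addrA.
  by rewrite rot_casimir// [LHS]addrC addrA.
have Cc : Lc (sph_lap f) = sph_lap (Lc f).
  rewrite !sph_lap_dim3//; last exact: Cinf_rot.
  rewrite [X in rot _ _ X](_ : _ = Lc (Lc f) + La (La f) + Lb (Lb f)); last first.
    by rewrite [LHS]addrC addrA.
  by rewrite rot_casimir// -addrA addrC.
pose M (F : (V -> R) -> (V -> R)) : V -> R :=
  La (F f) * La (F f) + Lb (F f) * Lb (F f) + Lc (F f) * Lc (F f).
pose G : V -> R := M La + M Lb + M Lc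
  - (La f * La f + Lb f * Lb f + Lc f * Lc f) - 2^-1 *: (sph_lap f * sph_lap f).
have Ta := TL i1 i2 _ Tf; have Tb := TL i2 i0 _ Tf; have Tc := TL i0 i1 _ Tf.
have TM : [/\ testfun (M La), testfun (M Lb) & testfun (M Lc)].
  split; rewrite /M; tst.
have [TMa TMb TMc] := TM.
have TG : testfun G by rewrite /G; tst.
have IM p q : testfun (M (rot p q)) -> Itg (w 2 * M (rot p q)) =
    br (La (rot p q f)) (La (rot p q f)) + br (Lb (rot p q f)) (Lb (rot p q f))
      + br (Lc (rot p q f)) (Lc (rot p q f)).
  by move=> _; rewrite /M !mulrDr testfun_Itg_D ?testfun_Itg_D//; tst.
have : 0 <= Itg (w 2 * G).
  apply: Itg_ge0 => x; rewrite [leRHS]/= ptM mulr_ge0 ?w_ge0//.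
  (* [tangent_hessian_ineq] carries a factor s^2, which can be cancelled only off the origin; at the
     origin [G] vanishes. *)
  have [s0|s0] := leP (sq x) 0.
    have [a [b [a0 H]]] := TG.2; rewrite H//; left.
    by rewrite (le_lt_trans s0).
  have s20 : 0 < sq x ^+ 2 by rewrite exprn_gt0.
  rewrite -(ler_pM2l s20) mulr0.
  have F i j := congr1 (@^~ x) (coord_rot2_dim3 i j Cf).
  have Fa := congr1 (@^~ x) (coord_rot_dim3 (La f)).
  have Fb := congr1 (@^~ x) (coord_rot_dim3 (Lb f)).
  have Fc := congr1 (@^~ x) (coord_rot_dim3 (Lc f)).
  have F0 := congr1 (@^~ x) (coord_rot_dim3 f).
  have F1 := F i1 i2; have F2 := F i2 i0; have F3 := F i0 i1.
  move: F0 Fa Fb Fc F1 F2 F3; rewrite !rot_coord /G /M sph_lap_dim3// !ptE !eqE/=.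
  rewrite !mulr0n !mulr1n => F0 Fa Fb Fc F1 F2 F3.
  have sE : sq x = coordf i0 x ^+ 2 + coordf i1 x ^+ 2 + coordf i2 x ^+ 2.
    by rewrite /sq sum_ord3.
  have := tangent_hessian_ineq Fa Fb Fc _ _ _ F0 sE.
  move: F1 F2 F3.
  move: (La (La f) x) (La (Lb f) x) (La (Lc f) x) => m00 m01 m02.
  move: (Lb (La f) x) (Lb (Lb f) x) (Lb (Lc f) x) => m10 m11 m12.
  move: (Lc (La f) x) (Lc (Lb f) x) (Lc (Lc f) x) => m20 m21 m22.
  move: (La f x) (Lb f x) (Lc f x) => l0 l1 l2.
  move: (coordf i0 x) (coordf i1 x) (coordf i2 x) => x0 x1 x2 F1 F2 F3 H.
  rewrite -subr_ge0 in H.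
  apply: le_trans (H _ _ _) _.
  - by rewrite F1; ring.
  - by rewrite F2; ring.
  - by rewrite F3; ring.
  - by rewrite le_eqVlt; apply/orP; left; apply/eqP; field.
have -> : Itg (w 2 * G) = Itg (w 2 * M La) + Itg (w 2 * M Lb) + Itg (w 2 * M Lc)
    - S - 2^-1 * br (sph_lap f) (sph_lap f).
  move: TMa TMb TMc; rewrite /G; move: (M La) (M Lb) (M Lc) => Ma Mb Mc TMa TMb TMc.
  rewrite /S /br !mulrDr !mulrN -fscalerAr.
  rewrite testfun_Itg_D ?testfun_Itg_N; [|tst|tst|tst]; rewrite testfun_Itg_Z; last by tst.
  rewrite testfun_Itg_D ?testfun_Itg_N; [|tst|tst|tst].
  by rewrite !(mulrDr (w 2)) !testfun_Itg_D; tst.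
rewrite (IM _ _ TMa) (IM _ _ TMb) (IM _ _ TMc).
rewrite -(brLD _ _ Ca) -(brLD _ _ Cb) -(brLD _ _ Cc).
have -> : br (sph_lap f) (sph_lap f) = br (sph_lap f) (La (La f)) + br (sph_lap f) (Lb (Lb f))
    + br (sph_lap f) (Lc (Lc f)).
  rewrite {2}sph_lap_dim3// brDr ?brDr//; tst.
move: (br _ _) (br _ _) (br _ _) S => u v t S'; lra.
Qed.

Theorem br_lap_dim3 f : testfun f ->
  br (rad_lap f) (rad_lap f) <= br (rad_lap f + sph_lap f) (rad_lap f + sph_lap f).
Proof.
move=> Tf; have TQ := testfun_rad_lap Tf; have TD := testfun_sph_lap Tf.
have TQD : testfun (rad_lap f + sph_lap f) by tst.
rewrite (brDl TQ TD TQD) (brDr TQ TD TQ) (brDr TQ TD TD) [br (rad_lap f) (sph_lap f)]brC.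
rewrite -addrA lerDl.
have := br_sph_lap_rad_lap Tf; have := br_lich Tf.
have : 0 <= \sum_i \sum_j br (rot i j f) (rot i j f).
  by apply: sumr_ge0 => i _; apply: sumr_ge0 => j _; exact: br_ge0.
(* With c = -3/4 the cross term is at least -3/4 of the sum of the |L_ij f|^2, and |D f|^2 is at
   least the whole sum: a quarter of it remains. *)
rewrite /rellich_const.
move: (br _ _) (br _ _) (\sum_i _) => u v t; lra.
Qed.

End dimension3.

(** * Complex-valued functions *)

Section complex_functions.
Context {R : realType} {n : nat}.
Local Notation V := 'rV[R]_n.
Local Notation rpart := (@complex.Re R).
Local Notation ipart := (@complex.Im R).
Implicit Types (f : V -> R[i]) (u v : V -> R) (x : V) (i j k : 'I_n).

Lemma Re_partial i f : rpart \o partial i f = pd i (rpart \o f).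
Proof. by apply/funext => x; rewrite pdE. Qed.

Lemma Im_partial i f : ipart \o partial i f = pd i (ipart \o f).
Proof. by apply/funext => x; rewrite pdE. Qed.

Lemma foldr_Re_partial f s :
  rpart \o foldr (@partial R n) f s = foldr (@pd R n) (rpart \o f) s.
Proof. by elim: s => //= i s <-; exact: Re_partial. Qed.

Lemma foldr_Im_partial f s :
  ipart \o foldr (@partial R n) f s = foldr (@pd R n) (ipart \o f) s.
Proof. by elim: s => //= i s <-; exact: Im_partial. Qed.

Lemma foldr_pd_Cinf u :
  (forall s, let g := foldr (@pd R n) u s in
     continuous g /\ forall x i, derivable g x (evec i)) -> Cinf u.
Proof.
move=> H k; rewrite -[u]/(foldr (@pd R n) u [::]).
elim: k [::] => [|k IHk] s; split=> //; try exact: (H s).1.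
by move=> i; split; [move=> x; exact: (H s).2|exact: (IHk (i :: s))].
Qed.

Lemma Cinf_foldr_pd u s : Cinf u -> Cinf (foldr (@pd R n) u s).
Proof. by move=> Cu; elim: s => //= i s IHs; exact: Cinf_pd. Qed.

Lemma smooth_Cinf f : smooth f -> Cinf (rpart \o f) /\ Cinf (ipart \o f).
Proof.
move=> Sf; split; apply: foldr_pd_Cinf => s g; have [c1 c2 d] := Sf s.
  by rewrite /g -foldr_Re_partial; split; [exact: c1|move=> x i; have [] := d x i].
by rewrite /g -foldr_Im_partial; split; [exact: c2|move=> x i; have [] := d x i].
Qed.

Lemma Cinf_smooth f : Cinf (rpart \o f) -> Cinf (ipart \o f) -> smooth f.
Proof.
move=> C1 C2 s g; rewrite /g foldr_Re_partial foldr_Im_partial.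
have D1 := Cinf_foldr_pd s C1; have D2 := Cinf_foldr_pd s C2.
split; [exact: Cinf_continuous|exact: Cinf_continuous|].
by move=> x i; split; exact: Cinf_derivable.
Qed.

Lemma coord_le_norm x i : `|x 0 i| <= `|x|.
Proof.
rewrite [leRHS]/Num.norm/= mx_normrE.
exact: (le_bigmax _ (fun ij : 'I_1 * 'I_n => `|x ij.1 ij.2|) (0, i)).
Qed.

Lemma sq_le_norm x : sq x <= n%:R * `|x| ^+ 2.
Proof.
rewrite /sq mulr_natl -[X in _ *+ X](card_ord n) -sumr_const.
apply: ler_sum => i _; rewrite -[leLHS]real_normK ?num_real//.
by rewrite lerXn2r ?nnegrE// coord_le_norm.
Qed.

Lemma sq0 : sq (0 : V) = 0.
Proof. by rewrite /sq big1// => i _; rewrite mxE expr0n. Qed.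

Lemma punctured_annular f : punctured_test_function f ->
  exists a b, 0 < a /\ forall x, sq x < a \/ b < sq x -> f x = 0.
Proof.
move=> [_ cf f0]; have : \forall x \near (0 : V), f x = 0.
  apply: contrapT => H; apply: f0 => B B0.
  apply: contrapT => AB; apply: H; apply: filterS B0 => x Bx.
  by apply: contrapT => /eqP fx; apply: AB; exists x.
move=> /nbhs_ballP[e /= e0 He].
have [M [_ HM]] := compact_bounded cf.
pose K := `|M| + 1; have MK : M < K by rewrite (le_lt_trans (ler_norm M))// ltrDl.
(* The ball and the bound of the support refer to the sup norm, which is at most the Euclidean norm,
   while |x|^2 is at most n times its square. *)
exists (e ^+ 2), (n%:R * K ^+ 2); split; first by rewrite exprn_gt0.
move=> x [xe|xK].
  apply: He; split => // i j; rewrite ord1 mxE /ball/= sub0r normrN.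
  rewrite -(@ltr_pXn2r _ 2)// ?nnegrE ?normr_ge0 ?ltW// real_normK ?num_real//.
  exact: le_lt_trans (coord_sq_le x j) _.
apply: contrapT => /eqP fx; have /(HM _ MK) /= xM : closure [set x | f x != 0] x.
  exact: subset_closure.
move: xK; rewrite ltNge => /negP; apply.
rewrite (le_trans (sq_le_norm x))// ler_wpM2l//.
by rewrite lerXn2r ?nnegrE// (le_trans _ xM).
Qed.

Lemma punctured_Tst f : punctured_test_function f ->
  testfun (rpart \o f) /\ testfun (ipart \o f).
Proof.
move=> Pf; have [Sf _ _] := Pf; have [C1 C2] := smooth_Cinf Sf.
have [a [b [a0 H]]] := punctured_annular Pf.
by split; split=> //; exists a, b; split=> // x /H /= ->.
Qed.

Definition toC u : V -> R[i] := fun x => u x +i* 0.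

Lemma testfun_punctured u : testfun u -> punctured_test_function (toC u).
Proof.
move=> [Cu [a [b [a0 H]]]].
have sub : closure [set x | toC u x != 0] `<=` [set x | a <= sq x] `&` [set x | sq x <= b].
  rewrite [X in _ `<=` X](_ : _ = closure ([set x | a <= sq x] `&` [set x | sq x <= b])).
    apply: closureS => x /= ux.
    have ux0 : u x <> 0 by move=> ux0; move: ux; rewrite /toC ux0 eqxx.
    by split; rewrite leNgt; apply/negP => K; apply: ux0; apply: H; [left|right].
  apply/closure_id; apply: closedI.
    rewrite [X in closed X](_ : _ = sq @^-1` [set y | a <= y]); last by apply/seteqP; split.
    by apply: closed_comp => [x _|]; [exact: continuous_sq|exact: closed_ge].
  rewrite [X in closed X](_ : _ = sq @^-1` [set y | y <= b]); last by apply/seteqP; split.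
  by apply: closed_comp => [x _|]; [exact: continuous_sq|exact: closed_le].
split.
- apply: Cinf_smooth => //; exact: Cinf_cst.
- apply: (subclosed_compact _ (@sq_ball_compact R n b)).
    exact: closed_closure.
  by move=> x /sub[].
- by move=> /sub[/=]; rewrite sq0 leNgt a0.
Qed.

Lemma Re_realM (a : R) (z : R[i]) : rpart (a%:C * z) = a * rpart z.
Proof. by case: z => p q /=; rewrite mul0r subr0. Qed.

Lemma Im_realM (a : R) (z : R[i]) : ipart (a%:C * z) = a * ipart z.
Proof. by case: z => p q /=; rewrite mul0r addr0. Qed.

Lemma Re_sum (J : Type) (r : seq J) (F : J -> R[i]) :
  rpart (\sum_(p <- r) F p) = \sum_(p <- r) rpart (F p).
Proof. by elim/big_rec2 : _ => // p y1 y2 _ <-; case: (F p) => ? ?; case: y2. Qed.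

Lemma Im_sum (J : Type) (r : seq J) (F : J -> R[i]) :
  ipart (\sum_(p <- r) F p) = \sum_(p <- r) ipart (F p).
Proof. by elim/big_rec2 : _ => // p y1 y2 _ <-; case: (F p) => ? ?; case: y2. Qed.

Lemma Re_D (y z : R[i]) : rpart (y + z) = rpart y + rpart z.
Proof. by case: y; case: z. Qed.

Lemma Im_D (y z : R[i]) : ipart (y + z) = ipart y + ipart z.
Proof. by case: y; case: z. Qed.

Lemma enormV x : 0 < sq x -> (enorm x)^-1 = w 2^-1 x.
Proof. by move=> x0; rewrite /w powRN powR12_sqrt ?sq_ge0. Qed.

Lemma testfun_at0 u x : testfun u -> sq x = 0 -> u x = 0.
Proof. by move=> [_ [a [b [a0 H]]]] x0; rewrite H// x0; left. Qed.

Lemma sq_cases x : sq x = 0 \/ 0 < sq x.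
Proof. by have := sq_ge0 x; rewrite le_eqVlt => /predU1P[<-|]; [left|right]. Qed.

Lemma radial_sumE u x : testfun u ->
  \sum_i x 0 i / enorm x * pd i u x = w 2^-1 x * euler u x.
Proof.
move=> Tu; have [x0|x0] := sq_cases x.
  rewrite (testfun_at0 (testfun_euler Tu) x0) mulr0 big1// => i _.
  by rewrite (testfun_at0 (testfun_pd i Tu) x0) mulr0.
rewrite -enormV// /euler fct_sumE mulr_sumr; apply: eq_bigr => i _.
by rewrite ptM /coordf mulrA [(enorm x)^-1 * _]mulrC.
Qed.

Lemma Re_radial_derivative f : testfun (rpart \o f) ->
  rpart \o radial_derivative f = w 2^-1 * euler (rpart \o f).
Proof.
move=> Tf; apply/funext => x /=; rewrite Re_sum ptM -radial_sumE//.
by apply: eq_bigr => i _; rewrite Re_realM -Re_partial.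
Qed.

Lemma Im_radial_derivative f : testfun (ipart \o f) ->
  ipart \o radial_derivative f = w 2^-1 * euler (ipart \o f).
Proof.
move=> Tf; apply/funext => x /=; rewrite Im_sum ptM -radial_sumE//.
by apply: eq_bigr => i _; rewrite Im_realM -Im_partial.
Qed.

Lemma w_half2 u : testfun u -> w 2^-1 * (w 2^-1 * u) = w 1 * u.
Proof. by move=> Tu; rewrite wMw//; congr (w _ * _); field. Qed.

(** The radial derivative is |x|^-1 E, and moving E past |x|^-1 turns it into E - 1. This is how the
    coefficient n - 1 becomes the n - 2 of [rad_lap]. *)
Lemma radial_laplacianE u : testfun u ->
  w 2^-1 * euler (w 2^-1 * euler u) + (n%:R - 1) *: (w 2^-1 * (w 2^-1 * euler u)) =
  w 1 * rad_lap u.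
Proof.
move=> Tu; have TE := testfun_euler Tu; have TEE := testfun_euler TE.
rewrite euler_w// mulrBr -fscalerAr !w_half2// /rad_lap mulrDr -fscalerAr.
by apply/funext => x; rewrite !ptE; field.
Qed.

Lemma scal_radial u x : testfun u -> (n%:R - 1) / enorm x * u x =
  ((n%:R - 1) *: (w 2^-1 * u)) x.
Proof.
move=> Tu; have [x0|x0] := sq_cases x.
  by rewrite !ptE (testfun_at0 Tu x0) !mulr0.
by rewrite !ptE enormV// mulrA.
Qed.

Lemma Re_radial_laplacian f : testfun (rpart \o f) ->
  rpart \o radial_laplacian f = w 1 * rad_lap (rpart \o f).
Proof.
move=> Tf; have TE := testfun_euler Tf; have TwE : testfun (w 2^-1 * euler (rpart \o f)) by tst.
have H := Re_radial_derivative Tf.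
rewrite -radial_laplacianE//; apply/funext => x.
rewrite [LHS]/= Re_D Re_realM -[rpart (radial_derivative f x)]/((rpart \o radial_derivative f) x).
rewrite -[rpart (radial_derivative _ x)]/((rpart \o radial_derivative (radial_derivative f)) x).
rewrite Re_radial_derivative; last by rewrite H.
by rewrite H scal_radial.
Qed.

Lemma Im_radial_laplacian f : testfun (ipart \o f) ->
  ipart \o radial_laplacian f = w 1 * rad_lap (ipart \o f).
Proof.
move=> Tf; have TE := testfun_euler Tf; have TwE : testfun (w 2^-1 * euler (ipart \o f)) by tst.
have H := Im_radial_derivative Tf.
rewrite -radial_laplacianE//; apply/funext => x.
rewrite [LHS]/= Im_D Im_realM -[ipart (radial_derivative f x)]/((ipart \o radial_derivative f) x).
rewrite -[ipart (radial_derivative _ x)]/((ipart \o radial_derivative (radial_derivative f)) x).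
rewrite Im_radial_derivative; last by rewrite H.
by rewrite H scal_radial.
Qed.

Lemma w1_lap u : testfun u -> lap u = w 1 * (rad_lap u + sph_lap u).
Proof.
move=> Tu; rewrite -sq_lap; last by case: Tu.
by rewrite w1_sq// /lap; tst.
Qed.

Lemma Re_laplacian f : testfun (rpart \o f) ->
  rpart \o laplacian f = w 1 * (rad_lap (rpart \o f) + sph_lap (rpart \o f)).
Proof.
move=> Tf; rewrite -w1_lap//; apply/funext => x /=.
rewrite Re_sum /lap fct_sumE; apply: eq_bigr => i _.
by rewrite -!Re_partial.
Qed.

Lemma Im_laplacian f : testfun (ipart \o f) ->
  ipart \o laplacian f = w 1 * (rad_lap (ipart \o f) + sph_lap (ipart \o f)).
Proof.
move=> Tf; rewrite -w1_lap//; apply/funext => x /=.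
rewrite Im_sum /lap fct_sumE; apply: eq_bigr => i _.
by rewrite -!Im_partial.
Qed.

Lemma div_norm_sqE f x : div_norm_sq f x = (w 1 x)%:C * f x.
Proof. by rewrite /div_norm_sq mulrC -fmorphV /= w1E /enorm sqr_sqrtr// sq_ge0. Qed.

Lemma Re_div_norm_sq f : rpart \o div_norm_sq f = w 1 * (rpart \o f).
Proof. by apply/funext => x /=; rewrite div_norm_sqE Re_realM. Qed.

Lemma Im_div_norm_sq f : ipart \o div_norm_sq f = w 1 * (ipart \o f).
Proof. by apply/funext => x /=; rewrite div_norm_sqE Im_realM. Qed.

(** The factors |x|^-2 in the real and imaginary parts combine, after squaring, into the weight of
    [br]. *)
Lemma L2norm_br f u v : testfun u -> testfun v -> rpart \o f = w 1 * u ->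
  ipart \o f = w 1 * v -> L2norm f = (Num.sqrt (br u u + br v v))%:E.
Proof.
move=> Tu Tv fu fv; rewrite /L2norm unlock.
have Tuv : testfun (u * u + v * v) by tst.
rewrite -powR12_sqrt ?addr_ge0 ?br_ge0// -[RHS]/((_)%:E `^ _)%E; congr (_ `^ _)%E.
have -> : br u u + br v v = Itg (w 2 * (u * u + v * v)).
  by rewrite /br -testfun_Itg_D ?mulrDr//; tst.
rewrite /Itg /Rintegral fineK; last first.
  have TT : testfun (w 2 * (u * u + v * v)) by tst.
  exact: (integrable_fin_num measurableT (testfun_integ TT)).
apply: eq_integral => t _; rewrite /= -/(rv t); congr (_%:E).
have -> : w 2 * (u * u + v * v) = (w 1 * u) * (w 1 * u) + (w 1 * v) * (w 1 * v).
  have -> : 2 = 1 + 1 :> R by [].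
  by rewrite mulrDr -!mulrA ![u * (w 1 * _)]mulrCA ![v * (w 1 * _)]mulrCA !wMw//; tst.
rewrite -fu -fv !ptE /=; case: (f (rv t)) => p q /=.
by rewrite powR_mulrn// real_normK ?num_real// sqr_sqrtr ?addr_ge0 ?sqr_ge0.
Qed.

End complex_functions.

(** * Radial cutoff functions *)

Section flat_function.
Context {R : realType}.
Implicit Types (t : R) (m : nat).

(** The classical exp(-1/t), extended by 0. The powers of 1/t make the family stable under
    differentiation up to linear combinations, so smoothness of all its members follows by one
    induction. *)
Definition flat m t : R := if 0 < t then t^-1 ^+ m * expR (- t^-1) else 0.

Lemma flat0 m t : t <= 0 -> flat m t = 0.
Proof. by move=> t0; rewrite /flat ltNge t0. Qed.

Lemma flat_gt0 m t : 0 < t -> 0 < flat m t.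
Proof. by move=> t0; rewrite /flat t0 mulr_gt0 ?exprn_gt0 ?invr_gt0 ?expR_gt0. Qed.

(** With y = 1/t, this is exp y >= y^(m+2) / (m+2)!. The quadratic bound is what makes the
    difference quotient at 0 tend to 0. *)
Lemma flat_le_sq m t : `|flat m t| <= (m.+2)`!%:R * t ^+ 2.
Proof.
have [t0|t0] := leP t 0; first by rewrite flat0// normr0 mulr_ge0 ?sqr_ge0.
rewrite gtr0_norm ?flat_gt0// /flat t0 expRN.
have [y y0 ->] : exists2 y, 0 < y & t = y^-1.
  by exists t^-1; rewrite ?invrK// invr_gt0.
rewrite invrK.
rewrite ler_pdivrMr ?expR_gt0//.
have := expR_ge1Dxn m.+1 (ltW y0); set e := expR y => H.
have F0 : 0 < (m.+2)`!%:R :> R by rewrite ltr0n fact_gt0.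
have : y ^+ m.+2 <= (m.+2)`!%:R * e.
  rewrite mulrC -ler_pdivrMr//; apply: le_trans H; lra.
move=> K; rewrite exprVn mulrAC.
by rewrite ler_pdivlMr ?exprn_gt0// -exprD addn2.
Qed.

Lemma is_derive_flat m t :
  is_derive t 1 (flat m) (flat m.+2 t - m%:R * flat m.+1 t).
Proof.
have [t0|t0|->] := ltgtP t 0.
- rewrite !flat0 ?(ltW t0)// mulr0 subr0.
  apply: (@near_eq_is_derive _ _ _ (cst 0)).
  by apply: filterS (lt_nbhsl t0) => s s0; rewrite flat0// ltW.
- apply: (@near_eq_is_derive _ _ _ (fun s : R => s^-1 ^+ m * expR (- s^-1))).
    by apply: filterS (lt_nbhsr t0) => s s0; rewrite /flat s0.
  have D1 : is_derive t 1 (fun s : R => s^-1) (- t ^- 2 *: 1).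
    by apply: is_deriveV; rewrite gt_eqF.
  have D2 := @is_deriveX _ _ _ m _ _ _ D1.
  have D3 : is_derive t 1 (fun s : R => expR (- s^-1)) (expR (- t^-1) * (- (- t ^- 2 *: 1))).
    have DN := @is_deriveN _ _ _ (fun s : R => s^-1) _ _ _ D1.
    exact: (@is_derive1_comp _ expR (fun s : R => - s^-1) t _ _ (is_derive_expR _) DN).
  have D4 := @is_deriveM _ _ _ _ _ _ _ _ D2 D3.
  have XE s : ((fun s : R => s^-1) ^+ m) s = s^-1 ^+ m by rewrite exprfctE.
  have quotE : (fun s : R => s^-1 ^+ m * expR (- s^-1)) =
      (fun s : R => s^-1) ^+ m * (fun s : R => expR (- s^-1)).
    by apply/funext => s; rewrite -XE.
  rewrite quotE; apply: is_derive_eq D4 _; rewrite XE /flat t0 /GRing.scale/= -exprVn !mulr1.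
  by case: m {D2 XE quotE} => [|m]; rewrite ?expr0 /= ?exprS; ring.
- rewrite !flat0// mulr0 subr0.
  have quotE : (fun h : R => h^-1 *: ((flat m \o shift 0) (h *: 1) - flat m 0)) @ 0^' --> (0 : R).
    apply/cvgrPdist_le => /= e e0.
    pose C : R := (m.+2)`!%:R; have C0 : 0 < C by rewrite ltr0n fact_gt0.
    near=> h; rewrite /= addr0 [flat m 0]flat0// subr0 [h%:A]mulr1 sub0r normrN.
    have h0 : h != 0 by near: h; exact: nbhs_dnbhs_neq.
    rewrite normrM normfV ler_pdivrMl ?normr_gt0//.
    apply: le_trans (flat_le_sq m h) _; rewrite -real_normK ?num_real// expr2 mulrCA.
    rewrite ler_wpM2l// -ler_pdivlMl// mulrC.
    near: h; apply: dnbhs0_le; exact: divr_gt0.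
  by apply: DeriveDef; [apply/cvg_ex; exists 0; exact: quotE|exact/cvg_lim].
Unshelve. all: by end_near. Qed.

Lemma continuous_flat m : continuous (flat m).
Proof.
move=> t; apply/differentiable_continuous/derivable1_diffP.
by case: (is_derive_flat m t).
Qed.

End flat_function.

(* [zeta x = 0] for [|x|^2 <= 1], and [zeta] is a positive constant for
   [|x|^2 >= 2], without any division by a bump function. *)
HB.lock Definition zeta {R : realType} {n : nat} : 'rV[R]_n -> R :=
  flat 0 \o (cst (expR (-1)) - (flat 0 \o (cst 2 - @sq R n))).

Section cutoff.
Context {R : realType} {n : nat}.
Local Notation V := 'rV[R]_n.
Implicit Types (f g u : V -> R) (x : V) (i j k : 'I_n) (a b c : R).

Lemma pd_flat i m u : Cinf u -> pd i (flat m \o u) =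
  ((flat m.+2 \o u) - m%:R *: (flat m.+1 \o u)) * pd i u.
Proof.
move=> Cu; apply/funext => x; rewrite pdE.
have D1 : is_derive x (evec i) u (pd i u x).
  by rewrite pdE; exact/derivableP/Cinf_derivable.
by case: (is_derive_comp1 D1 (is_derive_flat m (u x))).
Qed.

Lemma Cinf_flat m u : Cinf u -> Cinf (flat m \o u).
Proof.
move=> Cu k; elim: k m => [|k IHk] m; (split; first by
  move=> x; apply: (@continuous_comp _ _ _ u (flat m));
  [exact: Cinf_continuous|exact: continuous_flat]) => //.
move=> i; split.
  move=> x; have D1 : is_derive x (evec i) u (pd i u x).
    by rewrite pdE; exact/derivableP/Cinf_derivable.
  by case: (is_derive_comp1 D1 (is_derive_flat m (u x))).
rewrite pd_flat//; apply: Ck_M; last exact: Cinf_pd.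
rewrite -scaleNr scale_funE; apply: Ck_D => //; apply: Ck_M => //; exact: Ck_cst.
Qed.

Lemma rot_flat i j m u : Cinf u -> rot i j u = 0 -> rot i j (flat m \o u) = 0.
Proof.
move=> Cu; rewrite !rotE !pd_flat// => H.
by rewrite !(mulrCA (coordf _)) -mulrBr H mulr0.
Qed.

Lemma rot_cst i j c : rot i j (cst c : V -> R) = 0.
Proof.
rewrite rotE !pd_cst; apply/funext => x; rewrite !ptE; rewrite /cst; ring.
Qed.

Lemma rot_sq i j : rot i j (@sq R n) = 0.
Proof. by rewrite rotE !pd_sq; apply/funext => x; rewrite !ptE; ring. Qed.

Definition zeta_top : R := flat 0 (expR (-1)).

Lemma zeta_top_gt0 : 0 < zeta_top.
Proof. by rewrite flat_gt0// expR_gt0. Qed.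

End cutoff.

(** * Dilations and cutoffs with a long plateau *)

Section dilations.
Context {R : realType} {n : nat}.
Local Notation V := 'rV[R]_n.
Implicit Types (f g u : V -> R) (x : V) (i j k : 'I_n) (a b c : R).

Lemma Cinf_zeta : Cinf (zeta : V -> R).
Proof.
rewrite zeta.unlock; apply: Cinf_flat; apply: Cinf_D; first exact: Cinf_cst.
apply: Cinf_N; apply: Cinf_flat; apply: Cinf_D; first exact: Cinf_cst.
by apply: Cinf_N; exact: Cinf_sq.
Qed.

Lemma rot_zeta i j : rot i j (zeta : V -> R) = 0.
Proof.
have C1 : Cinf (cst 2 - @sq R n : V -> R).
  by apply: Cinf_D; [exact: Cinf_cst|apply: Cinf_N; exact: Cinf_sq].
have C2 : Cinf (flat 0 \o (cst 2 - @sq R n) : V -> R) by exact: Cinf_flat.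
have C3 c : Cinf (cst c : V -> R) by exact: Cinf_cst.
have C4 : Cinf (@sq R n) by exact: Cinf_sq.
rewrite zeta.unlock; apply: rot_flat; first by apply: Cinf_D => //; exact: Cinf_N.
rewrite rot_D//; last exact: Cinf_N.
rewrite rot_N// rot_cst sub0r rot_flat ?oppr0// rot_D//; last exact: Cinf_N.
by rewrite rot_N// rot_cst rot_sq subrr.
Qed.

Lemma zeta0 x : sq x <= 1 -> zeta x = 0.
Proof.
(* exp(-1) is the value of [flat 0] at 1, and 2 - |x|^2 >= 1 here, so the inner function is
   nonpositive. *)
move=> x1; rewrite zeta.unlock/= flat0// -[leLHS]/(expR (-1) - flat 0 (2 - sq x)).
have s0 : 0 < 2 - sq x by lra.
rewrite subr_le0 /flat s0 expr0 mul1r ler_expR lerN2 invf_le1//; lra.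
Qed.

Lemma zeta1 x : 2 <= sq x -> zeta x = zeta_top.
Proof.
move=> x2; rewrite zeta.unlock/= -[X in flat 0 X]/(expR (-1) - flat 0 (2 - sq x)).
by rewrite [flat 0 (2 - _)]flat0 ?subr0// subr_le0.
Qed.

Lemma pd_near_cst i f x c : (\forall y \near x, f y = c) -> pd i f x = 0.
Proof.
by move=> f0; rewrite pdE (near_eq_derive (g := cst c))// derive_cst.
Qed.

Lemma pd_zeta0 i x : sq x < 1 \/ 2 < sq x -> pd i zeta x = 0.
Proof.
move=> [x1|x2].
  apply: (@pd_near_cst _ _ _ 0); apply: filterS (near_sq_lt x1) => y y1.
  by apply: zeta0; exact: ltW.
apply: (@pd_near_cst _ _ _ zeta_top); apply: filterS (near_sq_gt x2) => y y2.
by apply: zeta1; exact: ltW.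
Qed.

Definition shell f := forall x, sq x < 1 \/ 2 < sq x -> f x = 0.

Lemma euler_at0 f x : (forall i, pd i f x = 0) -> euler f x = 0.
Proof. by move=> H; rewrite /euler fct_sumE big1// => i _; rewrite ptM H mulr0. Qed.

Lemma shell_euler f : shell f -> shell (euler f).
Proof.
move=> Hf x Hx; apply: euler_at0 => i; apply: pd_near0.
case: Hx => [x1|x2].
  by apply: filterS (near_sq_lt x1) => y y1; apply: Hf; left.
by apply: filterS (near_sq_gt x2) => y y2; apply: Hf; right.
Qed.

Lemma shell_euler_zeta : shell (euler (zeta : V -> R)).
Proof. by move=> x Hx; apply: euler_at0 => i; exact: pd_zeta0. Qed.

Lemma shell_bound f : Cinf f -> shell f -> exists K, forall x, `|f x| <= K.
Proof.
move=> Cf Sf; apply: continuous_bounded_support; first exact: Cinf_continuous.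
by exists 2 => x x2; apply: Sf; right.
Qed.

Definition dil c f : V -> R := fun x => f (c *: x).

Lemma sqZ c x : sq (c *: x) = c ^+ 2 * sq x.
Proof.
by rewrite /sq mulr_sumr; apply: eq_bigr => i _; rewrite mxE exprMn.
Qed.

Lemma is_derive_dil c i f x : Cinf f ->
  is_derive x (evec i) (dil c f) (c * pd i f (c *: x)).
Proof.
move=> Cf.
have F1 : is_derive (c * 0 : R) 1 (fun t : R => f (t *: evec i + c *: x)) (pd i f (c *: x)).
  rewrite pdE mulr0; apply: is_derive_line; last exact: Cinf_derivable.
  by move=> t; rewrite addr0.
have F2 : is_derive (0 : R) 1 (fun t : R => c * t) c.
  have := @is_deriveZ _ _ _ (id : R -> R) c (0 : R) 1 1 (is_derive_id _ _).
  by rewrite [c *: 1]mulr1.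
have F3 := @is_derive1_comp R (fun t : R => f (t *: evec i + c *: x)) _ _ _ _ F1 F2.
have E3 : (fun t : R => t^-1 *: ((dil c f \o shift x) (t *: evec i) - dil c f x)) =
    (fun t : R => t^-1 *: ((((fun t : R => f (t *: evec i + c *: x)) \o
      (fun t : R => c * t)) \o shift 0) (t *: 1) -
      ((fun t : R => f (t *: evec i + c *: x)) \o (fun t : R => c * t)) 0)).
  apply/funext => t; rewrite /= /dil mulr0 scale0r add0r addr0 [t%:A]mulr1.
  by rewrite [c *: (_ + _)]scalerDr [c *: (_ *: _)]scalerA.
case: F3 => F31 F32; rewrite mulrC.
by apply: DeriveDef; [rewrite /derivable E3; exact: F31|rewrite /derive E3; exact: F32].
Qed.

Lemma pd_dil c i f : Cinf f -> pd i (dil c f) = c *: dil c (pd i f).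
Proof.
by move=> Cf; apply/funext => x; rewrite pdE; case: (is_derive_dil c i x Cf).
Qed.

Lemma continuous_dil c f : continuous f -> continuous (dil c f).
Proof.
move=> cf x; apply: (@continuous_comp V V R (fun y : V => c *: y) f x).
  exact: scaler_continuous.
exact: cf.
Qed.

Lemma Cinf_dil c f : Cinf f -> Cinf (dil c f).
Proof.
move=> Cf k; elim: k f Cf => [|k IHk] f Cf; (split; first by
  apply: continuous_dil; exact: Cinf_continuous) => //.
move=> i; split; first by move=> x; case: (is_derive_dil c i x Cf).
rewrite pd_dil// scale_funE; apply: Ck_M; first exact: Ck_cst.
by apply: IHk; exact: Cinf_pd.
Qed.

Lemma euler_dil c f : Cinf f -> euler (dil c f) = dil c (euler f).
Proof.
move=> Cf; apply/funext => x; rewrite /dil /euler !fct_sumE; apply: eq_bigr => i _.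
by rewrite pd_dil// !ptM ptZ /coordf mxE mulrCA mulrA.
Qed.

Lemma rot_dil c i j f : Cinf f -> rot i j (dil c f) = dil c (rot i j f).
Proof.
move=> Cf; apply/funext => x; rewrite /dil !rotE !pd_dil//.
rewrite !(ptM, ptD, ptN, ptZ) /coordf !mxE /dil; ring.
Qed.

Lemma shell_dil_Tst c f : 0 < c -> Cinf f -> shell f -> testfun (dil c f).
Proof.
move=> c0 Cf Sf; split; first exact: Cinf_dil.
have c20 : 0 < c ^+ 2 by rewrite exprn_gt0.
exists (c ^- 2), (2 * c ^- 2); split; first by rewrite invr_gt0.
move=> x Hx; apply: Sf; rewrite sqZ mulrC.
by case: Hx => Hx; [left; rewrite -ltr_pdivlMr// mul1r|right; rewrite -ltr_pdivrMr].
Qed.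

(** Subtracting a dilate cancels the constant value of [zeta] at infinity. The Euler derivatives of
    [phi c] are differences of one function carried by a fixed shell and its dilate, hence bounds
    uniform in [c]. *)
Definition phi c : V -> R := zeta - dil c zeta.

Lemma rot_phi c i j : rot i j (phi c) = 0.
Proof.
have Cz := Cinf_zeta; have Cd := Cinf_dil c Cz.
rewrite /phi rot_D//; last exact: Cinf_N.
by rewrite rot_N// rot_dil// rot_zeta; apply/funext => x; rewrite ptD ptN /dil !pt0 subr0.
Qed.

Lemma Cinf_phi c : Cinf (phi c).
Proof.
apply: Cinf_D; first exact: Cinf_zeta.
by apply: Cinf_N; apply: Cinf_dil; exact: Cinf_zeta.
Qed.

Lemma phi_small c x : 0 < c <= 1 -> sq x < 1 -> phi c x = 0.
Proof.
move=> /andP[c0 c1] x1; rewrite /phi ptD ptN /dil !zeta0 ?subrr ?(ltW x1)//.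
rewrite sqZ -[leRHS]mulr1 ler_pM ?sq_ge0 ?sqr_ge0 ?(ltW x1)//.
by rewrite exprn_ile1// ltW.
Qed.

Lemma testfun_phi c : 0 < c <= 1 -> testfun (phi c).
Proof.
move=> c01; have /andP[c0 c1] := c01; split; first exact: Cinf_phi.
have c20 : 0 < c ^+ 2 by rewrite exprn_gt0.
exists 1, (2 * c ^- 2); split=> // x [x1|x2]; first exact: phi_small.
have x3 : 2 <= sq (c *: x) by rewrite sqZ mulrC -ler_pdivrMr// ltW.
rewrite /phi ptD ptN /dil !zeta1 ?subrr//.
apply: le_trans x3 _; rewrite sqZ -[leRHS]mul1r ler_wpM2r ?sq_ge0//.
by rewrite exprn_ile1// ltW.
Qed.

Lemma phi_top c x : 2 <= sq x -> c ^+ 2 * sq x <= 1 -> phi c x = zeta_top.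
Proof.
by move=> x2 cx; rewrite /phi ptD ptN /dil zeta1// zeta0 ?subr0// sqZ.
Qed.

Lemma euler_phi c : euler (phi c) = euler zeta - dil c (euler zeta).
Proof.
have Cz := Cinf_zeta; have Cd := Cinf_dil c Cz.
by rewrite /phi (euler_D Cz (Cinf_N Cd)) (euler_N Cd) euler_dil.
Qed.

Lemma euler_euler_phi c : euler (euler (phi c)) = euler (euler zeta) - dil c (euler (euler zeta)).
Proof.
have Cz := Cinf_euler Cinf_zeta; have Cd := Cinf_dil c Cz.
by rewrite euler_phi (euler_D Cz (Cinf_N Cd)) (euler_N Cd) euler_dil.
Qed.

Lemma w_nat2 (m : nat) x : w (m%:R / 2) x = (Num.sqrt (sq x) ^+ m)^-1.
Proof.
rewrite /w powRN mulrC powRrM powR12_sqrt ?sq_ge0// powR_mulrn// sqrtr_ge0.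
Qed.

Definition box (A : 'I_n -> set R) : set V := [set x | forall i, A i (x 0 i)].

Lemma Itg_box A (K : R) : (forall i, measurable (A i)) -> 
  (\prod_(i < n) @lebesgue_measure R (A i) < +oo)%E ->
  integ (K *: \1_(box A) : V -> R) /\
  Itg (K *: \1_(box A)) = K * fine (\prod_(i < n) @lebesgue_measure R (A i))%E.
Proof.
move=> mA fA; set B := [set t : n.-tuple (measurableTypeR R) | forall i, A i (tnth t i)].
have mB : measurable B by exact: box_measurable.
have BE : lebesgue_tuple R n B = (\prod_(i < n) @lebesgue_measure R (A i))%E.
  exact: (tuple_measure_box (@lebesgue_measure R) mA).
have E1 : (\1_(box A) \o @rv R n : n.-tuple (measurableTypeR R) -> R) = \1_B.
  apply/funext => t; rewrite /= !indicE; congr (_%:R); congr nat_of_bool.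
  by apply/asboolP/asboolP => H i; have := H i; rewrite mxE.
have int1 : integ (\1_(box A) : V -> R).
  rewrite /integ E1; apply: (@bounded_support_integrable _ _ _ _ _ B 1) => //.
  - by rewrite -BE in fA; exact: fA.
  - by move=> t; rewrite indicE; case: (_ \in _); rewrite ?normr1 ?normr0.
  - by move=> t Bt; rewrite indicE memNset.
split.
  rewrite /integ (_ : _ \o _ = (fun t => K%:E * (EFin \o (\1_(box A) \o @rv R n)) t)%E).
    exact: integrableZl.
  by apply/funext => t.
rewrite Itg_Z//; congr (_ * _); rewrite /Itg /Rintegral.
rewrite (eq_integral (fun t => (\1_B t)%:E)); last first.
  by move=> t _; rewrite -E1.
by rewrite integral_indic// setIT; congr fine; exact: BE.
Qed.

(* The scalar product of [L^2(|x|^-n dx)], which is invariant under dilations. *)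
Definition bw f g : R := Itg (w (n%:R / 2) * (f * g)).

(** The dilated shell lies in a cube of side 4 / c, and on it |x| >= 1 / c, so that the weight is at
    most c^n. The powers of c cancel. *)
Lemma bw_dil_le c f (K : R) : 0 < c -> Cinf f -> shell f ->
  (forall x, `|f x| <= K) -> bw (dil c f) (dil c f) <= K ^+ 2 * 4 ^+ n.
Proof.
move=> c0 Cf Sf fK; have Td := shell_dil_Tst c0 Cf Sf.
have K0 : 0 <= K by rewrite (le_trans _ (fK 0)).
pose A (i : 'I_n) := `[- (2 / c), 2 / c]%classic : set R.
have mA i : measurable (A i) by exact: measurable_itv.
have prodA : (\prod_(i < n) @lebesgue_measure R (A i))%E = ((4 / c) ^+ n)%:E.
  rewrite (eq_bigr (fun=> (4 / c)%:E)).
    by rewrite prodEFin prodr_const card_ord.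
  move=> i _; rewrite [LHS]lebesgue_measure_itv/= lte_fin.
  rewrite gtrN ?divr_gt0// -EFinB; congr (_%:E); by field; rewrite gt_eqF.
have [intB IB] := Itg_box (K ^+ 2 * c ^+ n) mA (eq_ind_r (fun z => (z < +oo)%E) (ltry _) prodA).
rewrite (_ : K ^+ 2 * 4 ^+ n = Itg ((K ^+ 2 * c ^+ n) *: \1_(box A))); last first.
  rewrite IB prodA/= expr_div_n -mulrA; congr (_ * _); rewrite mulrCA mulfV ?mulr1//.
  by rewrite expf_neq0// gt_eqF.
have TT : testfun (w (n%:R / 2) * (dil c f * dil c f)) by tst.
apply: (Itg_le (testfun_integ TT) intB) => x; rewrite ptZ indicE !ptM; have [/set_mem xA|] := boolP (x \in box A); last first.
  rewrite notin_setE => xA.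
  rewrite mulr0; suff -> : dil c f x = 0 by rewrite !mulr0.
  move/existsNP : xA => [i /= xi]; apply: Sf; right; rewrite sqZ.
  rewrite (lt_le_trans _ (ler_wpM2l (sqr_ge0 c) (coord_sq_le x i)))//.
  have : 2 / c < `|x 0 i|.
    by rewrite ltNge; apply/negP => H; apply: xi; rewrite /A/= in_itv/= -ler_norml.
  rewrite ltr_pdivrMr// => H.
  rewrite -exprMn -[X in _ < X]real_normK ?num_real// normrM (gtr0_norm c0) mulrC.
  by move: H; move: (_ * c) => y H; nra.
rewrite mulr1; have [cx1|cx1] := ltP (sq (c *: x)) 1.
  have -> : dil c f x = 0 by apply: Sf; left.
  by rewrite !mulr0 mulr_ge0 ?sqr_ge0 ?exprn_ge0 ?ltW.
rewrite mulrC; apply: ler_pM; rewrite ?w_ge0// -?expr2 ?sqr_ge0//.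
  rewrite -[leLHS]real_normK ?num_real// lerXn2r ?nnegrE//.
  exact: fK.
rewrite w_nat2 -exprVn lerXn2r ?nnegrE ?invr_ge0 ?sqrtr_ge0 ?(ltW c0)//.
have r2 := sqr_sqrtr (sq_ge0 x); have r0 := sqrtr_ge0 (sq x).
rewrite sqZ -r2 in cx1; move: r0 cx1; move: (Num.sqrt _) => r r0 cr.
have rp : 0 < r.
  by rewrite lt_neqAle r0 andbT eq_sym; apply: contraTneq cr => ->; rewrite expr0n mulr0 -ltNge.
rewrite -div1r ler_pdivrMr//.
have cr0 : 0 <= c * r by rewrite mulr_ge0// ltW.
by move: cr cr0; rewrite -exprMn; move: (c * r) => y; nra.
Qed.

End dilations.

(** * Norms of the cutoff functions *)

Section estimates.
Context {R : realType} {n : nat}.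
Local Notation V := 'rV[R]_n.
Implicit Types (f g u : V -> R) (x : V) (i j k : 'I_n) (a b c : R).

Lemma bw_sub_le c f (K : R) : 0 < c -> Cinf f -> shell f ->
  (forall x, `|f x| <= K) ->
  bw (f - dil c f) (f - dil c f) <= 4 * (K ^+ 2 * 4 ^+ n).
Proof.
move=> c0 Cf Sf fK; have Td := shell_dil_Tst c0 Cf Sf.
have f1 : dil 1 f = f by apply/funext => x; rewrite /dil scale1r.
have Tf : testfun f by rewrite -f1; exact: shell_dil_Tst.
have B1 := bw_dil_le ltr01 Cf Sf fK; rewrite f1 in B1.
have B2 := bw_dil_le c0 Cf Sf fK.
have T1 : testfun (w (n%:R / 2) * ((f - dil c f) * (f - dil c f))) by tst.
have T2 : testfun (w (n%:R / 2) * (f * f)) by tst.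
have T3 : testfun (w (n%:R / 2) * (dil c f * dil c f)) by tst.
have T4 : testfun (2 *: (w (n%:R / 2) * (f * f)) +
  2 *: (w (n%:R / 2) * (dil c f * dil c f))) by tst.
have : bw (f - dil c f) (f - dil c f) <= Itg (2 *: (w (n%:R / 2) * (f * f)) +
  2 *: (w (n%:R / 2) * (dil c f * dil c f))).
  apply: (Itg_le (testfun_integ T1) (testfun_integ T4)) => x; rewrite !ptE.
  move: (w _ x) (w_ge0 (n%:R / 2) x) (f x) (dil c f x) => ww ww0 p q.
  rewrite -subr_ge0 (_ : _ - _ = ww * (p + q) ^+ 2); last by ring.
  by rewrite mulr_ge0// sqr_ge0.
rewrite testfun_Itg_D; [|tst|tst]; rewrite (testfun_Itg_Z _ T2) (testfun_Itg_Z _ T3) -!/(bw _ _).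
move: B1 B2; move: (bw _ _) (bw _ _) (bw _ _) (K ^+ 2 * _) => p q r s; lra.
Qed.

Lemma integ_sum (N : nat) (F : 'I_N -> V -> R) : (forall l, integ (F l)) ->
  integ (\sum_l F l) /\ Itg (\sum_l F l) = \sum_l Itg (F l).
Proof.
elim: N F => [|N IHN] F iF.
  rewrite !big_ord0; split; first exact: testfun_integ testfun_0.
  by have := testfun_Itg_Z 0 (@testfun_0 R n); rewrite scaler0 mul0r.
rewrite !big_ord_recr/=; have [i1 E1] := IHN (fun l => F (widen_ord (leqnSn N) l)) (fun l => iF _).
split; last by rewrite Itg_D ?E1.
exact: (integrableD measurableT i1 (iF ord_max)).
Qed.

Lemma sq_sum_le x (a : R) : (forall i, x 0 i ^+ 2 <= a) -> sq x <= n%:R * a.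
Proof.
move=> H; rewrite /sq mulr_natl -[X in _ *+ X](card_ord n) -sumr_const.
by apply: ler_sum => i _; exact: H.
Qed.

Lemma sq_sum_ge x (a : R) : (forall i, a <= x 0 i ^+ 2) -> n%:R * a <= sq x.
Proof.
move=> H; rewrite /sq mulr_natl -[X in _ *+ X](card_ord n) -sumr_const.
by apply: ler_sum => i _; exact: H.
Qed.

(** The edges are half-open, which makes the cubes disjoint. They lie in the positive orthant, so
    each single coordinate is comparable to |x|. *)
Definition dyadic (l : nat) (i : 'I_n) : set R := `[2 ^+ l, 2 ^+ l.+1[%classic.

Lemma dyadic_inj (l m : nat) i (y : R) : dyadic l i y -> dyadic m i y -> l = m.
Proof.
rewrite /dyadic /= !in_itv/= => /andP[l1 l2] /andP[m1 m2].
have := le_lt_trans l1 m2; have := le_lt_trans m1 l2.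
by rewrite !ltr_eXn2l ?ltr1n// !ltnS => ? ?; apply/eqP; rewrite eqn_leq; apply/andP.
Qed.

(** On the cube of edge p = 2^l one has |x| <= 2 n p, |x|^2 <= 4 n p^2 and x_i >= p, while [phi]
    equals [zeta_top]. Up to the factor p^-n, this constant bounds |x|^(-n-2) (x_i phi)^2 from
    below. *)
Definition lower_const : R := (2 * n%:R) ^- n / (4 * n%:R) * (zeta_top : R) ^+ 2.

(** For l < N the l-th cube satisfies |x|^2 <= 4 n 4^l <= (2 n 2^N)^2, so it lies where the dilated
    [zeta] still vanishes. *)
Definition cutoff_scale (N : nat) : R := (2 * n%:R * 2 ^+ N)^-1.

Lemma dyadic_lower (N l : nat) i x : (2 <= n)%N -> (l < N)%N ->
  box (dyadic l) x ->
  lower_const / (2 ^+ l) ^+ n <=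
  w (n%:R / 2 + 1) x * ((coordf i * phi (cutoff_scale N)) x) ^+ 2.
Proof.
move=> n2 lN xl.
have n2R : 2 <= n%:R :> R by rewrite (ler_nat R 2 n).
pose p : R := 2 ^+ l; have p1 : 1 <= p by rewrite exprn_ege1// ler1n.
have Hx i' : p <= x 0 i' < 2 * p.
  by have := xl i'; rewrite /dyadic/= in_itv/= exprS.
have H1 i' : p ^+ 2 <= x 0 i' ^+ 2.
  by have /andP[] := Hx i'; move: (x 0 i') => y; nra.
have H2 i' : x 0 i' ^+ 2 <= 4 * p ^+ 2.
  by have /andP[] := Hx i'; move: (x 0 i') => y; nra.
have s1 := sq_sum_ge H1; have s2 := sq_sum_le H2.
(* The plateau of [zeta] starts at |x|^2 = 2, and |x|^2 >= n p^2 with n >= 2 and p >= 1. *)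
have s20 : 2 <= sq x by apply: le_trans s1; nra.
have s0 : 0 < sq x by rewrite (lt_le_trans _ s20).
have pN : p <= 2 ^+ N by rewrite ler_eXn2l ?ltr1n// ltnW.
have phE : phi (cutoff_scale N) x = zeta_top.
  apply: phi_top => //; rewrite /cutoff_scale exprVn mulrC ler_pdivrMr ?mul1r; last first.
    by rewrite exprn_gt0// !mulr_gt0// ?exprn_gt0// (lt_le_trans _ n2R).
  apply: (le_trans s2); move: pN; move: (2 ^+ N) => q pq.
  have : (n%:R * p) ^+ 2 <= (n%:R * q) ^+ 2.
    by rewrite lerXn2r ?nnegrE ?mulr_ge0// ?ler_pM2l//; lra.
  have : n%:R * p ^+ 2 <= (n%:R * p) ^+ 2.
    by rewrite exprMn ler_wpM2r ?sqr_ge0//; nra.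
  rewrite (_ : (2 * n%:R * q) ^+ 2 = 4 * (n%:R * q) ^+ 2); last by ring.
  rewrite (_ : n%:R * (4 * p ^+ 2) = 4 * (n%:R * p ^+ 2)); last by ring.
  move: (_ ^+ 2) => ?; lra.
rewrite ptM phE wD// w_nat2 w1E.
have r0 : 0 < Num.sqrt (sq x) by rewrite sqrtr_gt0.
have r1 : Num.sqrt (sq x) <= 2 * n%:R * p.
  rewrite -(@ler_pXn2r _ 2)// ?nnegrE ?sqrtr_ge0//; last by nra.
  rewrite sqr_sqrtr ?sq_ge0// (le_trans s2)//.
  rewrite (_ : (2 * n%:R * p) ^+ 2 = n%:R * (n%:R * (4 * p ^+ 2))); last by ring.
  by rewrite ler_wpM2l// -[leLHS]mul1r ler_wpM2r ?mulr_ge0 ?sqr_ge0//; lra.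
have np0 : 0 < 2 * n%:R * p by nra.
have -> : lower_const / (2 ^+ l) ^+ n =
    (((2 * n%:R * p) ^+ n)^-1 * (n%:R * (4 * p ^+ 2))^-1) * (p * zeta_top) ^+ 2.
  rewrite /lower_const -/p !exprMn; field.
  have n0 : n%:R != 0 :> R by rewrite gt_eqF//; lra.
  have p0 : p != 0 by rewrite gt_eqF//; lra.
  by rewrite !expf_neq0 ?p0 ?n0.
apply: ler_pM.
- by rewrite mulr_ge0 ?invr_ge0 ?exprn_ge0 ?mulr_ge0 ?sqr_ge0//; lra.
- exact: sqr_ge0.
- apply: ler_pM; rewrite ?invr_ge0 ?exprn_ge0 ?(ltW np0)//.
  + have := sqr_ge0 p; nra.
  + rewrite lef_pV2 ?posrE ?exprn_gt0// lerXn2r ?nnegrE ?sqrtr_ge0//; exact: ltW.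
  + by rewrite lef_pV2 ?posrE//; apply: lt_le_trans s2.
- rewrite !exprMn ler_wpM2r ?sqr_ge0//; exact: H1.
Qed.

Lemma cutoff_scale_bounds (N : nat) : (2 <= n)%N -> 0 < cutoff_scale N <= 1.
Proof.
move=> n2; have n2R : 2 <= n%:R :> R by rewrite (ler_nat R 2 n).
have q1 : 1 <= 2 ^+ N :> R by rewrite exprn_ege1// ler1n.
have H : 1 <= 2 * n%:R * 2 ^+ N :> R by nra.
by rewrite /cutoff_scale invr_gt0 invf_le1 ?H ?(lt_le_trans _ H).
Qed.

Lemma lower_const_gt0 : (2 <= n)%N -> 0 < lower_const.
Proof.
move=> n2; have n0 : 0 < n%:R :> R by rewrite ltr0n (leq_trans _ n2).
by rewrite /lower_const mulr_gt0 ?exprn_gt0 ?zeta_top_gt0// divr_gt0 ?invr_gt0 ?exprn_gt0 ?mulr_gt0.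
Qed.

(** The volume 2^(l n) of the l-th cube compensates the decay of |x|^-n, so N disjoint cubes
    contribute at least [lower_const] each. The factor x_i^2 / |x|^2 <= 1 lets one estimate serve
    both the radial example and the planar one. *)
Lemma phi_lower (N : nat) i : (2 <= n)%N ->
  lower_const * N%:R <= Itg (w (n%:R / 2 + 1) *
    ((coordf i * phi (cutoff_scale N)) * (coordf i * phi (cutoff_scale N)))).
Proof.
move=> n2; have Tp : testfun (phi (cutoff_scale N) : V -> R) := testfun_phi (cutoff_scale_bounds N n2).
have mD l i' : measurable (dyadic l i') by exact: measurable_itv.
have prodD (l : nat) : (\prod_(i' < n) @lebesgue_measure R (dyadic l i'))%E =
    ((2 ^+ l) ^+ n)%:E.
  rewrite (eq_bigr (fun=> (2 ^+ l)%:E)).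
    by rewrite prodEFin prodr_const card_ord.
  move=> i' _; rewrite [LHS]lebesgue_measure_itv/= lte_fin.
  rewrite ltr_eXn2l ?ltr1n// ltnSn -EFinB; congr (_%:E).
  rewrite exprS; ring.
pose F (l : 'I_N) : V -> R := (lower_const / (2 ^+ l) ^+ n) *: \1_(box (dyadic l)).
have HF (l : 'I_N) : integ (F l) /\ Itg (F l) = lower_const.
  have [i1 ->] := Itg_box (lower_const / (2 ^+ l) ^+ n) (mD l)
    (eq_ind_r (fun z => (z < +oo)%E) (ltry _) (prodD l)).
  split=> //; rewrite prodD/= divfK// expf_neq0// expf_neq0//.
have [iS ES] := integ_sum (fun l => (HF l).1).
have -> : lower_const * N%:R = Itg (\sum_l F l).
  rewrite ES (eq_bigr (fun=> lower_const)) => [|l _]; last by rewrite (HF l).2.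
  by rewrite sumr_const card_ord mulr_natr.
have Tc := testfun_Ml (Cinf_coord i) Tp; have T1 := testfun_w (n%:R / 2 + 1) (testfun_M Tc Tc).
apply: (Itg_le iS (testfun_integ T1)) => x; rewrite fct_sumE ptM ptM -expr2.
have [/existsP[l /asboolP xl]|H] := boolP [exists l : 'I_N, `[< box (dyadic l) x >]].
  rewrite (bigD1 l)//= big1 ?addr0; last first.
    move=> m ml; rewrite /F ptZ indicE memNset ?mulr0// => xm.
    move: ml; rewrite -(inj_eq val_inj)/= => /eqP; apply.
    exact: (dyadic_inj (xm i) (xl i)).
  rewrite /F ptZ indicE mem_set// mulr1.
  exact: dyadic_lower.
rewrite big1; first by rewrite mulr_ge0 ?w_ge0// sqr_ge0.
move=> l _.
rewrite /F ptZ indicE memNset ?mulr0// => xl.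
by move/existsP : H; apply; exists l; exact/asboolP.
Qed.

End estimates.

Arguments cutoff_scale R n N : clear implicits.
Arguments lower_const R n : clear implicits.

(** * The inequalities and their sharpness *)

Section norms.
Context {R : realType} {n : nat}.
Local Notation V := 'rV[R]_n.
Local Notation rpart := (@complex.Re R).
Local Notation ipart := (@complex.Im R).
Implicit Types (f : V -> R[i]) (u v : V -> R) (x : V) (i j : 'I_n).

Lemma L2norm_radial_laplacian f : testfun (rpart \o f) -> testfun (ipart \o f) ->
  L2norm (radial_laplacian f) =
  (Num.sqrt (br (rad_lap (rpart \o f)) (rad_lap (rpart \o f)) +
             br (rad_lap (ipart \o f)) (rad_lap (ipart \o f))))%:E.
Proof.
move=> Tu Tv; apply: L2norm_br; rewrite ?Re_radial_laplacian ?Im_radial_laplacian //; exact: testfun_rad_lap.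
Qed.

Lemma L2norm_laplacian f : testfun (rpart \o f) -> testfun (ipart \o f) ->
  L2norm (laplacian f) =
  (Num.sqrt (br (rad_lap (rpart \o f) + sph_lap (rpart \o f)) (rad_lap (rpart \o f) + sph_lap (rpart \o f)) +
             br (rad_lap (ipart \o f) + sph_lap (ipart \o f)) (rad_lap (ipart \o f) + sph_lap (ipart \o f))))%:E.
Proof.
move=> Tu Tv; apply: L2norm_br; rewrite ?Re_laplacian ?Im_laplacian //; tst.
Qed.

Lemma L2norm_div_norm_sq f : testfun (rpart \o f) -> testfun (ipart \o f) ->
  L2norm (div_norm_sq f) =
  (Num.sqrt (br (rpart \o f) (rpart \o f) + br (ipart \o f) (ipart \o f)))%:E.
Proof.
move=> Tu Tv; apply: L2norm_br => //; [exact: Re_div_norm_sq|exact: Im_div_norm_sq].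
Qed.

Lemma rellich_ineq f : punctured_test_function f ->
  ((rellich_const R n ^+ 2)%:E * L2norm (div_norm_sq f) ^+ 2 <=
   L2norm (radial_laplacian f) ^+ 2)%E.
Proof.
move=> /punctured_Tst[Tu Tv].
rewrite L2norm_radial_laplacian// L2norm_div_norm_sq// -!EFin_expe -EFinM lee_fin.
rewrite !sqr_sqrtr ?addr_ge0 ?br_ge0// mulrDr.
by apply: lerD; exact: br_rellich.
Qed.

Lemma zero_L2 : [/\ br (rad_lap (0 : V -> R)) (rad_lap 0) = 0,
  br (rad_lap (0 : V -> R) + sph_lap 0) (rad_lap 0 + sph_lap 0) = 0 & br (0 : V -> R) 0 = 0].
Proof.
have T0 := @testfun_0 R n; have C0 : Cinf (0 : V -> R) by case: T0.
have E0 : euler (0 : V -> R) = 0 by rewrite -(scale0r (0 : V -> R)) euler_Z// !scale0r.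
have L0 i j : rot i j (0 : V -> R) = 0.
  by rewrite -(scale0r (0 : V -> R)) rot_Z// !scale0r.
have Q0 : rad_lap (0 : V -> R) = 0 by rewrite /rad_lap !E0 scaler0 addr0.
have D0 : sph_lap (0 : V -> R) = 0.
  rewrite /sph_lap big1 ?scaler0// => i _; rewrite big1// => j _.
  by rewrite !L0.
have b0 : br (0 : V -> R) 0 = 0 by have := brZl 0 T0 T0; rewrite scale0r mul0r.
by rewrite Q0 D0 addr0.
Qed.

Lemma toC_norms u : testfun u ->
  [/\ L2norm (radial_laplacian (toC u)) = (Num.sqrt (br (rad_lap u) (rad_lap u)))%:E,
      L2norm (laplacian (toC u)) = (Num.sqrt (br (rad_lap u + sph_lap u) (rad_lap u + sph_lap u)))%:E &
      L2norm (div_norm_sq (toC u)) = (Num.sqrt (br u u))%:E].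
Proof.
move=> Tu; have T0 := @testfun_0 R n; have [z1 z2 z3] := zero_L2.
have H1 := @L2norm_radial_laplacian (toC u) Tu T0.
have H2 := @L2norm_laplacian (toC u) Tu T0.
have H3 := @L2norm_div_norm_sq (toC u) Tu T0.
split.
- by rewrite H1 -[X in _ + X]/(br (rad_lap (0 : V -> R)) (rad_lap 0)) z1 addr0.
- by rewrite H2 -[X in _ + X]/(br (rad_lap (0 : V -> R) + sph_lap 0) (rad_lap 0 + sph_lap 0)) z2 addr0.
- by rewrite H3 -[X in _ + X]/(br (0 : V -> R) 0) z3 addr0.
Qed.

End norms.

Lemma laplacian_ineq (R : realType) (n : nat) (f : 'rV[R]_n -> R[i]) :
  (3 <= n)%N -> punctured_test_function f ->
  (L2norm (radial_laplacian f) <= L2norm (laplacian f))%E.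
Proof.
move=> n3 /punctured_Tst[Tu Tv].
rewrite L2norm_radial_laplacian// L2norm_laplacian// lee_fin ler_wsqrtr//.
have [n4|n4] := leqP 4 n; first by apply: lerD; exact: br_lap_ge4.
have n3E : n = 3%N by apply/eqP; rewrite eqn_leq n3 -ltnS n4.
by move: f Tu Tv; rewrite n3E => f Tu Tv; apply: lerD; exact: br_lap_dim3.
Qed.

(** * Near-extremal functions and the planar counterexample *)

Section sharpness.
Context {R : realType} {n : nat}.
Local Notation V := 'rV[R]_n.
Implicit Types (f g u v : V -> R) (x : V) (i j : 'I_n).
Local Notation c := (rellich_const R n).

Lemma sph_lap_radial u : (forall i j, rot i j u = 0) -> sph_lap u = 0.
Proof.
move=> H; rewrite /sph_lap big1 ?scaler0// => i _; rewrite big1// => j _.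
by rewrite H -(scale0r (0 : V -> R)) rot_Z ?scale0r//; exact: Cinf_cst.
Qed.

Lemma shell_difference_bound f : Cinf f -> shell f ->
  exists B : R, forall c, 0 < c -> bw (f - dil c f) (f - dil c f) <= B.
Proof.
move=> Cf Sf; have [K fK] := shell_bound Cf Sf.
by exists (4 * (K ^+ 2 * 4 ^+ n)) => c c0; exact: bw_sub_le.
Qed.

Let a : R := (n%:R - 4) / 4.

Definition radial_profile (N : nat) : V -> R :=
  w ((n%:R - 4) / 4) * phi (cutoff_scale R n N).

Hypothesis n2 : (2 <= n)%N.

Let TP N : testfun (phi (cutoff_scale R n N) : V -> R).
Proof. exact: testfun_phi (cutoff_scale_bounds N n2). Qed.

Lemma testfun_radial_profile N : testfun (radial_profile N).
Proof. exact: testfun_w. Qed.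

(** The power |x|^(-(n-4)/2) is homogeneous of exactly the degree that [skew_euler] annihilates. *)
Lemma skew_euler_w g : testfun g -> skew_euler (w a * g) = w a * euler g.
Proof.
move=> Tg; rewrite /skew_euler euler_w//; apply/funext => x; rewrite !ptE /a; by field.
Qed.

Lemma br_w g h : testfun g -> testfun h -> br (w a * g) (w a * h) = bw g h.
Proof.
move=> Tg Th; have Tgh : testfun (g * h) by tst.
rewrite /br /bw mulrACA -!mulrA (wMw _ _ (testfun_w a Tgh)) (wMw _ _ Tgh).
have aE : 2 + a + a = n%:R / 2 :> R by rewrite /a; field.
by rewrite aE.
Qed.

Lemma sph_lap_radial_profile N : sph_lap (radial_profile N) = 0.
Proof.
by apply: sph_lap_radial => i j; rewrite rot_w ?rot_phi ?mulr0.
Qed.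

Let i0 : 'I_n := Ordinal (leq_trans (isT : (0 < 2)%N) n2).

Lemma bw_phi_ge N : lower_const R n * N%:R <=
  bw (phi (cutoff_scale R n N) : V -> R) (phi (cutoff_scale R n N)).
Proof.
apply: (le_trans (phi_lower N i0 n2)).
have Tc := testfun_Ml (Cinf_coord i0) (TP N).
apply: (Itg_le (testfun_integ (testfun_w _ (testfun_M Tc Tc)))
  (testfun_integ (testfun_w _ (testfun_M (TP N) (TP N))))) => x.
rewrite !ptM; have [x0|x0] := sq_cases x.
  by rewrite (testfun_at0 (TP N) x0) !mulr0.
rewrite wD// w1E -mulrA ler_wpM2l ?w_ge0// mulrC ler_pdivrMr//.
rewrite -!expr2 exprMn mulrC; apply: ler_wpM2l; first exact: sqr_ge0.
exact: coord_sq_le.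
Qed.

Lemma rellich_sharp (C : R) : c ^+ 2 < C ->
  exists u, testfun u /\ br (rad_lap u) (rad_lap u) < C * br u u.
Proof.
move=> cC.
have CE := Cinf_euler (@Cinf_zeta R n); have CEE := Cinf_euler CE.
have [B1 HB1] := shell_difference_bound CE (@shell_euler_zeta R n).
have [B2 HB2] := shell_difference_bound CEE (shell_euler (@shell_euler_zeta R n)).
have l0 := @lower_const_gt0 R n n2.
have d0 : 0 < lower_const R n * (C - c ^+ 2) by rewrite mulr_gt0 ?subr_gt0.
(* [B] bounds, for all N, the part of [br_rad_lap] other than c^2 |f|^2. As |f|^2 >= [lower_const]
   N, the margin (C - c^2) |f|^2 exceeds [B] for the chosen N. *)
pose B := B2 + (2 * c + 4) * B1.
pose N := Num.bound `|B / (lower_const R n * (C - c ^+ 2))|.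
have HN : B < lower_const R n * (C - c ^+ 2) * N%:R.
  rewrite mulrC -ltr_pdivrMr//; apply: le_lt_trans (ler_norm _) _.
  exact: archi_boundP (normr_ge0 _).
exists (radial_profile N); split; first exact: testfun_radial_profile.
have Tp := TP N; have TE := testfun_euler Tp; have TEE := testfun_euler TE.
have /andP[s0 _] := @cutoff_scale_bounds R n N n2.
rewrite br_rad_lap; last exact: testfun_radial_profile.
rewrite /radial_profile -/a !skew_euler_w// !br_w//.
have := HB1 _ s0; have := HB2 _ s0; rewrite -euler_phi -euler_euler_phi => H2 H1.
have H3 := bw_phi_ge N; have k0 := @rellich_const_gt R n.
have H4 : (2 * c + 4) * bw (euler (phi (cutoff_scale R n N) : V -> R)) (euler (phi (cutoff_scale R n N)))
    <= (2 * c + 4) * B1 by apply: ler_wpM2l; [exact: ltW|exact: H1].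
have H5 : lower_const R n * N%:R * (C - c ^+ 2) <=
  bw (phi (cutoff_scale R n N) : V -> R) (phi (cutoff_scale R n N)) * (C - c ^+ 2).
  by rewrite ler_wpM2r// subr_ge0 ltW.
move: H2 H4 H5 HN; rewrite /B.
move: (bw _ _) (bw _ _) (bw _ _) => p q r; lra.
Qed.

Lemma euler_sq : euler (@sq R n) = 2 *: @sq R n.
Proof.
rewrite /euler; under eq_bigr do rewrite pd_sq -fscalerAr.
by rewrite -scaler_sumr sum_coord_sq.
Qed.

(** A virial argument that avoids definiteness of [br]. Since A (s u) = s A u + 2 s u and A is
    antisymmetric, <A u, s u> = - <u, s u>. As s >= 1 wherever u does not vanish, this is at most -
    |u|^2 < 0, whereas |A u| = 0 would force it to be 0 by Cauchy-Schwarz. *)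
Lemma br_skew_euler_gt0 u : testfun u -> (forall x, sq x < 1 -> u x = 0) -> 0 < br u u ->
  0 < br (skew_euler u) (skew_euler u).
Proof.
move=> Tu u1 u0; have TA := testfun_skew_euler Tu.
have Ts : testfun (sq * u) by tst.
have m0 : 0 < br u (sq * u).
  apply: lt_le_trans u0 _.
  have T1 : testfun (w 2 * (u * u)) by tst.
  have T2 : testfun (w 2 * (u * (sq * u))) by tst.
  apply: (Itg_le (testfun_integ T1) (testfun_integ T2)) => x; rewrite !ptM.
  have [x1|x1] := ltP (sq x) 1; first by rewrite u1// !mul0r.
  rewrite ler_wpM2l ?w_ge0// mulrCA -[leLHS]mul1r ler_wpM2r//.
  by rewrite -expr2 sqr_ge0.
have X : br (skew_euler u) (sq * u) = - br u (sq * u).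
  have AE : skew_euler (sq * u) = sq * skew_euler u + 2 *: (sq * u).
    rewrite /skew_euler euler_M ?euler_sq//; [|exact: Cinf_sq|by case: Tu].
    by apply/funext => x; rewrite !ptE; ring.
  have TsA : testfun (sq * skew_euler u) by tst.
  have T2 : testfun (2 *: (sq * u)) by tst.
  have := br_skew_euler Tu Ts; rewrite AE (brDr TsA T2 Tu) brZr//.
  have -> : br u (sq * skew_euler u) = br (skew_euler u) (sq * u).
    by rewrite /br; congr (Itg (_ * _)); rewrite mulrCA [u * _]mulrC mulrCA.
  move: (br _ _) (br _ _) => p q; lra.
rewrite lt_neqAle br_ge0 andbT eq_sym; apply/negP => /eqP A0.
pose M := br (sq * u) (sq * u); have M0 : 0 <= M by exact: br_ge0.
(* Near the minimizer of the quadratic polynomial |A u + t s u|^2 in t; the 1 avoids a division by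
   zero, and the value is still negative. *)
pose t := br u (sq * u) / (M + 1).
have Tt : testfun (t *: (sq * u)) by tst.
have TAt : testfun (skew_euler u + t *: (sq * u)) by tst.
have := br_ge0 (skew_euler u + t *: (sq * u)).
rewrite (brDl TA Tt TAt) (brDr TA Tt TA) (brDr TA Tt Tt) !brZl// !brZr//.
rewrite [br (sq * u) (skew_euler u)]brC X A0 -/M add0r.
rewrite (_ : _ + _ = - (br u (sq * u) ^+ 2 * (M + 2) / (M + 1) ^+ 2)); last first.
  by rewrite /t; field; rewrite gt_eqF//; lra.
rewrite oppr_ge0 leNgt divr_gt0 ?mulr_gt0 ?exprn_gt0//; lra.
Qed.

(** For C < 1 a single radial function of nonzero norm suffices. The Rellich inequality does not
    give that norm in dimension 4, where c = 0; the term (2 c + 4) |A u|^2 does in every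
    dimension. *)
Lemma radial_positive : exists u, [/\ testfun u, sph_lap u = 0 & 0 < br (rad_lap u) (rad_lap u)].
Proof.
exists (radial_profile 1); have Tu := testfun_radial_profile 1.
split=> //; first exact: sph_lap_radial_profile.
have u0 : 0 < br (radial_profile 1) (radial_profile 1).
  rewrite /radial_profile -/a br_w//; apply: lt_le_trans (bw_phi_ge 1).
  by rewrite mulr1 lower_const_gt0.
have u1 x : sq x < 1 -> radial_profile 1 x = 0.
  by move=> x1; rewrite /radial_profile ptM phi_small ?mulr0// cutoff_scale_bounds.
rewrite br_rad_lap//.
have := mulr_gt0 (@rellich_const_gt R n) (br_skew_euler_gt0 Tu u1 u0).
have := mulr_ge0 (sqr_ge0 c) (br_ge0 (radial_profile 1)).
have := br_ge0 (skew_euler (skew_euler (radial_profile 1))).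
move: (_ * _) (_ * _) (br _ _) => p q r; lra.
Qed.

Lemma sq_pd_radial i u : (forall j k, rot j k u = 0) -> sq * pd i u = coordf i * euler u.
Proof.
move=> H; rewrite -sum_coord_sq mulr_suml /euler mulr_sumr; apply: eq_bigr => j _.
have := H j i; rewrite rotE => /eqP; rewrite subr_eq0 => /eqP K.
by rewrite -mulrA K mulrCA.
Qed.

(** As x_i is harmonic, Delta (x_i u) = x_i Delta u + 2 d_i u, and s d_i u = x_i E u for radial u.
    No term in u itself survives, so the plateau of a cutoff contributes nothing. *)
Lemma rad_sph_lap_coord i u : testfun u -> (forall j k, rot j k u = 0) ->
  rad_lap (coordf i * u) + sph_lap (coordf i * u) = coordf i * (euler (euler u) + n%:R *: euler u).
Proof.
move=> Tu H; have [Cu _] := Tu; have Cc := @Cinf_coord R n.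
have Ccu : Cinf (coordf i * u) by exact: Cinf_M.
rewrite -sq_lap//.
have pdE j : pd j (pd j (coordf i * u)) =
    coordf i * pd j (pd j u) + (2 * (i == j)%:R) *: pd j u.
  have Cp := Cinf_pd j Cu.
  rewrite (CpdM _ (Cc i) Cu) pd_coord CpdD; [|exact: Cinf_M|].
    rewrite !CpdM ?pd_coord ?pd_cst//; [|exact: Cinf_cst].
    by apply/funext => x; rewrite !ptE /cst; ring.
  by apply: Cinf_M => //; exact: Cinf_cst.
have -> : lap (coordf i * u) = coordf i * lap u + 2 *: pd i u.
  rewrite /lap; under eq_bigr do rewrite pdE.
  rewrite big_split/= mulr_sumr; congr (_ + _).
  rewrite (bigD1 i)//= eqxx mulr1 big1 ?addr0// => j ji.
  by rewrite eq_sym (negbTE ji) mulr0 scale0r.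
rewrite mulrDr mulrCA sq_lap// sph_lap_radial// addr0 -fscalerAr sq_pd_radial//.
by apply/funext => x; rewrite /rad_lap !ptE; ring.
Qed.

Lemma dim2_unbounded (C : R) : n = 2%N ->
  exists u, testfun u /\ C * br (rad_lap u + sph_lap u) (rad_lap u + sph_lap u) < br (rad_lap u) (rad_lap u).
Proof.
move=> nE; have nR : n%:R = 2 :> R by rewrite nE.
have CE := Cinf_euler (@Cinf_zeta R n); have CEE := Cinf_euler CE.
pose psi : V -> R := euler (euler zeta) + n%:R *: euler zeta.
have Cpsi : Cinf psi by apply: Cinf_D => //; exact: Cinf_Z.
have Spsi : shell psi.
  move=> x Hx; rewrite /psi ptD ptZ (shell_euler (@shell_euler_zeta R n))//.
  by rewrite shell_euler_zeta// mulr0 addr0.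
have [B HB] := shell_difference_bound Cpsi Spsi.
have l0 := @lower_const_gt0 R n n2.
pose N := Num.bound `| `|C| * `|B| / lower_const R n|.
have HN : `|C| * `|B| < lower_const R n * N%:R.
  rewrite -ltr_pdivrMl// [_^-1 * _]mulrC; apply: le_lt_trans (ler_norm _) _.
  exact: archi_boundP (normr_ge0 _).
have Tp := TP N; have Tc := testfun_Ml (Cinf_coord i0) Tp.
have /andP[s0 _] := @cutoff_scale_bounds R n N n2.
exists (coordf i0 * phi (cutoff_scale R n N)); split=> //.
have Hlow : lower_const R n * N%:R <=
    br (coordf i0 * phi (cutoff_scale R n N)) (coordf i0 * phi (cutoff_scale R n N)).
  have := @phi_lower R n N i0 n2; rewrite nR.
  (* For n = 2 the weight of [phi_lower] is that of [br]. *)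
  by rewrite (_ : 2 / 2 + 1 = 2 :> R)//; field.
have Hr := br_rellich Tc.
(* c = -1 here, so the Rellich inequality bounds the radial norm below by the norm of f. *)
have c2 : c ^+ 2 = 1 by rewrite /rellich_const nR; field.
rewrite c2 mul1r in Hr; apply: lt_le_trans Hr; apply: lt_le_trans Hlow.
apply: le_lt_trans HN.
rewrite rad_sph_lap_coord//; last by move=> j k; exact: rot_phi.
set g := euler (euler _) + _.
have gE : g = psi - dil (cutoff_scale R n N) psi.
  rewrite /g euler_euler_phi euler_phi /psi; apply/funext => x; rewrite !(ptD, ptN, ptZ) /dil.
  by rewrite !(ptD, ptZ); ring.
have Tg : testfun g by rewrite /g; tst.
have Tcg := testfun_Ml (Cinf_coord i0) Tg.
have bg : br (coordf i0 * g) (coordf i0 * g) <= `|B|.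
  apply: le_trans (ler_norm B); apply: le_trans (HB _ s0); rewrite -gE.
  apply: (Itg_le (testfun_integ (testfun_w _ (testfun_M Tcg Tcg)))
    (testfun_integ (testfun_w _ (testfun_M Tg Tg)))) => x.
  rewrite !ptM nR divff ?pnatr_eq0//; have [x0|x0] := sq_cases x.
    by rewrite (testfun_at0 Tg x0) !mulr0.
  rewrite (_ : 2 = 1 + 1 :> R)// wD// -mulrA ler_wpM2l ?w_ge0// w1E mulrC ler_pdivrMr//.
  rewrite -!expr2 exprMn mulrC; apply: ler_wpM2l; first exact: sqr_ge0.
  exact: coord_sq_le.
apply: le_trans (ler_norm _) _; rewrite normrM ler_wpM2l// ger0_norm//.
exact: br_ge0.
Qed.

End sharpness.

Theorem theorem3 (R : realType) (n : nat) (hn : (2 <= n)%N) :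
  (forall f : 'rV[R]_n -> R[i], punctured_test_function f ->
     ((rellich_const R n ^+ 2)%:E * L2norm (div_norm_sq f) ^+ 2 <=
      L2norm (radial_laplacian f) ^+ 2)%E) /\
  ((3 <= n)%N ->
   forall f : 'rV[R]_n -> R[i], punctured_test_function f ->
     (L2norm (radial_laplacian f) <= 1%:E * L2norm (laplacian f))%E) /\
  (n = 2%N ->
   forall C : R, exists f : 'rV[R]_n -> R[i], punctured_test_function f /\
     ~ (L2norm (radial_laplacian f) <= C%:E * L2norm (laplacian f))%E) /\
  (forall C : R, rellich_const R n ^+ 2 < C ->
   exists f : 'rV[R]_n -> R[i], punctured_test_function f /\
     ~ (C%:E * L2norm (div_norm_sq f) ^+ 2 <=
        L2norm (radial_laplacian f) ^+ 2)%E) /\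
  ((3 <= n)%N ->
   forall C : R, C < 1 ->
   exists f : 'rV[R]_n -> R[i], punctured_test_function f /\
     ~ (L2norm (radial_laplacian f) <= C%:E * L2norm (laplacian f))%E).
Proof.
split; first by move=> f; exact: rellich_ineq.
split; first by move=> n3 f Pf; rewrite mul1e; exact: laplacian_ineq.
split.
  move=> nE C; have [u [Tu H]] := dim2_unbounded hn (C ^+ 2) nE.
  exists (toC u); split; first exact: testfun_punctured.
  have [-> -> _] := toC_norms Tu; rewrite -EFinM lee_fin => K.
  (* [C] may be negative; the right-hand side of [K] is nonnegative because it dominates a square
     root, which permits squaring. *)
  have := lerXn2r 2 _ _ K; rewrite !nnegrE sqrtr_ge0 (le_trans (sqrtr_ge0 _) K).
  move=> /(_ isT isT); rewrite exprMn !sqr_sqrtr ?br_ge0//.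
  by rewrite leNgt H.
split.
  move=> C cC; have [u [Tu H]] := rellich_sharp hn cC.
  exists (toC u); split; first exact: testfun_punctured.
  have [-> _ ->] := toC_norms Tu; rewrite -!EFin_expe -EFinM lee_fin.
  by rewrite !sqr_sqrtr ?br_ge0// leNgt H.
move=> n3 C C1; have [u [Tu Du H]] := @radial_positive R n hn.
exists (toC u); split; first exact: testfun_punctured.
have [-> -> _] := toC_norms Tu; rewrite Du addr0 -EFinM lee_fin.
have s0 : 0 < Num.sqrt (br (rad_lap u) (rad_lap u)) by rewrite sqrtr_gt0.
by rewrite -[leLHS]mul1r ler_pM2r// leNgt C1.
Qed.
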